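(* Let $\ell$ be a commutative unital ring, let $E$ be a directed graph (with arbitrary sets of vertices and edges), let $C(E)$ be its Cohn path algebra over $\ell$, and let $\varphi:\ell^{(E^0)}\to C(E)$ be the algebra homomorphism with $\varphi(\chi_v)=v$ for $v\in E^0$. Let $j:\mathrm{Alg}_\ell\to kk$ be the universal excisive, homotopy invariant and $E$-stable homology theory. Then $j(\varphi)$ is an isomorphism.
   Context: A directed graph $E=(E^0,E^1,r,s)$ has vertex set $E^0$, edge set $E^1$ and range and source maps $r,s:E^1\to E^0$. The Cohn path algebra $C(E)$ over $\ell$ is the quotient of the free associative $\ell$-algebra on $E^0\cup E^1\cup\{e^*:e\in E^1\}$ by the relations $vw=\delta_{v,w}v$ $(v,w\in E^0)$; $s(e)e=e=e\,r(e)$ and $r(e)e^*=e^*=e^*s(e)$ $(e\in E^1)$; $e^*f=\delta_{e,f}r(e)$ $(e,f\in E^1)$. $\ell^{(E^0)}$ is the algebra (pointwise operations) of finitely supported functions $E^0\to\ell$, and $\chi_v$ is the characteristic function of $\{v\}$. Homology theories and $kk$. $\mathrm{Alg}_\ell$ is the category of associative, not necessarily unital $\ell$-algebras. A homology theory is a functor $X:\mathrm{Alg}_\ell\to\mathcal T$ to a triangulated category $\mathcal T$ with inverse suspension $\Omega$. An extension is a short exact sequence of algebras $0\to A\to B\to C\to 0$ which splits $\ell$-linearly. $X$ is excisive if it comes equipped with maps $\partial:\Omega X(C)\to X(A)$, one for each extension, natural with respect to morphisms of extensions, such that $\Omega X(C)\to X(A)\to X(B)\to X(C)$ is a distinguished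 triangle. $X$ is homotopy invariant if it maps each inclusion $A\subset A[t]$ to an isomorphism. For a set $S$, $M_SA$ is the algebra of finitely supported $S\times S$-matrices with entries in $A$; $X$ is $M_S$-stable if for every $A$ and $s\in S$ it maps $A\to M_SA$, $a\mapsto \epsilon_{s,s}\otimes a$ to an isomorphism ($\epsilon_{s,t}$ are the matrix units). $X$ is $E$-stable if it is $M_S$-stable for $S=E^0\sqcup E^1\sqcup\mathbb{N}$. For each infinite set $S$ there is a universal excisive, homotopy invariant, $M_S$-stable homology theory $j:\mathrm{Alg}_\ell\to kk$, i.e. an initial one, where morphisms $X\to Y$ are triangulated functors $G$ with $GX=Y$ compatible with the maps $\partial$. *)

(* Defs.v *)
From HB Require Import structures.
From mathcomp Require Import all_boot all_algebra.
From mathcomp Require Import generic_quotient.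
From mathcomp Require Import boolp classical_sets functions cardinality fsbigop.

Set Implicit Arguments.
Unset Strict Implicit.
Unset Printing Implicit Defensive.

Import GRing.Theory.
Local Open Scope ring_scope.
Local Open Scope classical_set_scope.
Local Open Scope quotient_scope.

Declare Scope nualg_scope.
Declare Scope category_scope.
Local Open Scope nualg_scope.
Local Open Scope category_scope.

Reserved Notation "x *n y" (at level 40, left associativity).
Reserved Notation "g \oc f" (at level 50, left associativity).

Record nualg (l : comPzRingType) := NUAlg {
  nu_sort :> lmodType l;
  nu_mul : nu_sort -> nu_sort -> nu_sort;
  nu_mulA : associative nu_mul;
  nu_mulDl : left_distributive nu_mul +%R;
  nu_mulDr : right_distributive nu_mul +%R;
  nu_scaleAl : forall (a : l) x y, a *: nu_mul x y = nu_mul (a *: x) y;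
  nu_scaleAr : forall (a : l) x y, a *: nu_mul x y = nu_mul x (a *: y) }.

Notation "x *n y" := (nu_mul x y) : nualg_scope.

Record nuhom (l : comPzRingType) (A B : nualg l) := NUHom {
  nuh_fun :> {linear A -> B};
  nuhM : forall x y : A, nuh_fun (x *n y) = nuh_fun x *n nuh_fun y }.

Section NUAlgTheory.
Variable l : comPzRingType.
Implicit Types A B C D : nualg l.

Lemma nuhom_ext A B (f g : nuhom A B) : f =1 g -> f = g.
Proof.
case: f g => [f fM] [g gM] /= fg.
have e : f = g.
  case: f g fM gM fg => [f cf] [g cg] /= _ _ /funext fg.
  move: cf cg; rewrite fg => cf cg; congr GRing.Linear.Pack.
  case: cf cg => [[a] [b]] [[c] [d]].
  by rewrite (Prop_irrelevance a c) (Prop_irrelevance b d).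
by move: fM gM; rewrite e => fM gM; congr NUHom; exact: Prop_irrelevance.
Qed.

Lemma nu_mul0 A (x : A) : x *n 0 = 0.
Proof. by apply: (addrI (x *n 0)); rewrite -nu_mulDr !addr0. Qed.

Lemma nu_0mul A (x : A) : 0 *n x = 0.
Proof. by apply: (addrI (0 *n x)); rewrite -nu_mulDl !addr0. Qed.

Lemma nu_sumr A (I : Type) (r : seq I) (P : pred I) (F : I -> A) x :
  x *n (\sum_(i <- r | P i) F i) = \sum_(i <- r | P i) x *n F i.
Proof. by apply: (big_morph (nu_mul x)); [exact: nu_mulDr | exact: nu_mul0]. Qed.

Lemma nu_suml A (I : Type) (r : seq I) (P : pred I) (F : I -> A) x :
  (\sum_(i <- r | P i) F i) *n x = \sum_(i <- r | P i) F i *n x.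
Proof.
apply: (big_morph (fun y => y *n x)) => [y z|]; first exact: nu_mulDl.
exact: nu_0mul.
Qed.

Definition nuid A : nuhom A A := @NUHom l A A idfun (fun _ _ => erefl).

Definition nucomp A B C (g : nuhom B C) (f : nuhom A B) : nuhom A C.
Proof.
by apply: (@NUHom l A C (g \o f : {linear A -> C})) => x y /=; rewrite !nuhM.
Defined.

Lemma nucompA A B C D (h : nuhom C D) (g : nuhom B C) (f : nuhom A B) :
  nucomp h (nucomp g f) = nucomp (nucomp h g) f.
Proof. exact: nuhom_ext. Qed.

Lemma nucomp1m A B (f : nuhom A B) : nucomp (nuid B) f = f.
Proof. exact: nuhom_ext. Qed.

Lemma nucompm1 A B (f : nuhom A B) : nucomp f (nuid A) = f.
Proof. exact: nuhom_ext. Qed.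

End NUAlgTheory.

Section FiniteSupport.
Variables (l : comPzRingType) (S : choiceType) (V : lmodType l).

Definition fin_support : {pred S -> V} :=
  [pred f | `[< finite_set [set s | f s != 0] >]].

Record fsmod := FSMod { fs_fun :> S -> V; _ : fs_fun \in fin_support }.

HB.instance Definition _ := [isSub for fs_fun].
HB.instance Definition _ := [Choice of fsmod by <:].

Lemma fin_support_submod_closed : submod_closed fin_support.
Proof.
split.
  rewrite inE; apply: (@sub_finite_set _ _ set0) => // s /=.
  by rewrite eqxx.
move=> a f g; rewrite !inE => ff fg.
apply: (@sub_finite_set _ _ ([set s | f s != 0] `|` [set s | g s != 0])).
  move=> s /= h; have [f0|f0] := eqVneq (f s) 0; last by left.
  right; apply: contraNneq h => g0.
  by rewrite /GRing.add /= /GRing.scale /= f0 g0 scaler0 addr0.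
by rewrite finite_setU.
Qed.

HB.instance Definition _ :=
  GRing.isSubmodClosed.Build _ _ fin_support fin_support_submod_closed.
HB.instance Definition _ := [SubChoice_isSubLmodule of fsmod by <:].

Lemma fsP (f g : fsmod) : f =1 g -> f = g.
Proof. by move=> fg; apply: val_inj; apply: funext. Qed.

Lemma fs_finite (f : fsmod) : finite_set [set s | f s != 0].
Proof. by have := valP f; rewrite inE. Qed.

Definition mkfs (f : S -> V) (ff : finite_set [set s | f s != 0]) : fsmod :=
  @FSMod f (asboolT ff).

Lemma fs_add (f g : fsmod) s : (f + g) s = f s + g s.
Proof. by []. Qed.

Lemma fs_scale a (f : fsmod) s : (a *: f) s = a *: f s.
Proof. by []. Qed.

Lemma fs_single_finite (s : S) (v : V) :
  finite_set [set t | (if t == s then v else 0) != 0].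
Proof.
apply: (sub_finite_set _ (finite_set1 s)) => t /=.
by case: (t =P s) => // _; rewrite eqxx.
Qed.

Definition fs_single (s : S) (v : V) : fsmod := mkfs (fs_single_finite s v).

Lemma fs_singleE s v t : fs_single s v t = if t == s then v else 0.
Proof. by []. Qed.

Lemma fs_single_linear s : linear (fs_single s).
Proof.
move=> a u v; apply: fsP => t; rewrite fs_add fs_scale !fs_singleE.
by case: ifP => // _; rewrite scaler0 addr0.
Qed.

HB.instance Definition _ s :=
  GRing.isLinear.Build _ _ _ _ (fs_single s) (fs_single_linear s).

Lemma fs_seq (f : fsmod) : exists2 r, uniq r & forall s, f s != 0 -> s \in r.
Proof.
have /finite_seqP [r rE] := fs_finite f.
exists (undup r) => [|s fs]; first exact: undup_uniq.
by rewrite mem_undup; have : [set s | f s != 0] s by []; rewrite rE.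
Qed.

End FiniteSupport.

Arguments fs_single {l S V}.

Lemma fsum_seq (S : choiceType) (V : zmodType) (r : seq S) (F : S -> V) :
  uniq r -> (forall s, F s != 0 -> s \in r) ->
  \sum_(s \in setT) F s = \sum_(s <- r) F s.
Proof.
move=> ur Fr; rewrite (fsbig_seq _ _ ur); apply/esym/fsbig_widen => // s [_ /=].
by move=> /negP sr; apply/eqP; apply: contraNT sr => /Fr.
Qed.

Section FunctionAlgebra.
Variables (l : comPzRingType) (S : choiceType).

Lemma funalg_mul_finite (f g : fsmod S l^o) :
  finite_set [set s | (f s : l) * g s != 0].
Proof.
apply: (sub_finite_set _ (fs_finite f)) => s /=.
by apply: contraNneq => ->; rewrite mul0r.
Qed.

Definition funalg_mul (f g : fsmod S l^o) : fsmod S l^o :=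
  @mkfs l S l^o _ (funalg_mul_finite f g).

Definition funalg : nualg l.
Proof.
apply: (@NUAlg l (fsmod S l^o) funalg_mul).
- by move=> f g h; apply: fsP => s; exact: mulrA.
- by move=> f g h; apply: fsP => s; exact: mulrDl.
- by move=> f g h; apply: fsP => s; exact: mulrDr.
- by move=> a f g; apply: fsP => s; exact: mulrA.
- by move=> a f g; apply: fsP => s; exact: mulrCA.
Defined.

Definition chi (s : S) : funalg := fs_single s (1 : l^o).

End FunctionAlgebra.

Section PolynomialAlgebra.
Variables (l : comPzRingType) (A : nualg l).
Implicit Types p q r : fsmod nat A.

Lemma polyalg_mul_finite p q :
  finite_set [set n | \sum_(i < n.+1) p i *n q (n - i)%N != 0].
Proof.
apply: (sub_finite_set _ (finite_image2 addn (fs_finite p) (fs_finite q))).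
move=> n /= h.
have [i hi] : exists i : 'I_n.+1, p i *n q (n - i)%N != 0.
  apply/existsP; apply: contraNT h => /existsPn h.
  by rewrite big1 // => i _; have := h i; rewrite negbK => /eqP.
exists (i : nat).
  by apply: contraNneq hi => /= ->; rewrite nu_0mul.
exists (n - i)%N.
  by apply: contraNneq hi => /= ->; rewrite nu_mul0.
by rewrite subnKC // -ltnS.
Qed.

Definition polyalg_mul p q : fsmod nat A := mkfs (polyalg_mul_finite p q).

Lemma polyalg_mulE p q n : polyalg_mul p q n = \sum_(i < n.+1) p i *n q (n - i)%N.
Proof. by []. Qed.

Lemma polyalg_mulE_rev p q n :
  polyalg_mul p q n = \sum_(i < n.+1) p (n - i)%N *n q i.
Proof.
rewrite polyalg_mulE (reindex_inj rev_ord_inj) /=.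
by apply: eq_bigr => j _; rewrite (sub_ordK j).
Qed.

Lemma polyalg_mulA : associative polyalg_mul.
Proof.
move=> p q r; apply: fsP => i; rewrite polyalg_mulE polyalg_mulE_rev.
pose coef3 j k := p j *n (q (i - j - k)%N *n r k).
transitivity (\sum_(j < i.+1) \sum_(k < i.+1 | (k <= i - j)%N) coef3 j k).
  apply: eq_bigr => j _; rewrite polyalg_mulE_rev nu_sumr /=.
  by rewrite (big_ord_narrow_leq (leq_subr _ _)).
rewrite (exchange_big_dep predT) //; apply: eq_bigr => k _.
transitivity (\sum_(j < i.+1 | (j <= i - k)%N) coef3 j k).
  apply: eq_bigl => j; rewrite -ltnS -(ltnS j) -!subSn ?leq_ord //.
  by rewrite -subn_gt0 -(subn_gt0 j) -!subnDA addnC.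
rewrite (big_ord_narrow_leq (leq_subr _ _)) polyalg_mulE nu_suml /=.
by apply: eq_bigr => j _; rewrite /coef3 -!subnDA addnC nu_mulA.
Qed.

Definition polyalg : nualg l.
Proof.
apply: (@NUAlg l (fsmod nat A) polyalg_mul polyalg_mulA).
- move=> p q r; apply: fsP => n; rewrite fs_add !polyalg_mulE -big_split.
  by apply: eq_bigr => i _; rewrite fs_add nu_mulDl.
- move=> p q r; apply: fsP => n; rewrite fs_add !polyalg_mulE -big_split.
  by apply: eq_bigr => i _; rewrite fs_add nu_mulDr.
- move=> a p q; apply: fsP => n; rewrite fs_scale !polyalg_mulE scaler_sumr.
  by apply: eq_bigr => i _; rewrite fs_scale nu_scaleAl.
- move=> a p q; apply: fsP => n; rewrite fs_scale !polyalg_mulE scaler_sumr.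
  by apply: eq_bigr => i _; rewrite fs_scale nu_scaleAr.
Defined.

Definition polyalg_const : nuhom A polyalg.
Proof.
apply: (@NUHom l A polyalg (fs_single 0%N : {linear A -> polyalg})) => x y /=.
apply: fsP => n; rewrite [RHS]polyalg_mulE big_ord_recl subn0 /=.
rewrite big1 ?addr0 => [|i _]; last by rewrite nu_0mul.
by case: eqP => // _; rewrite nu_mul0.
Defined.

End PolynomialAlgebra.

Section MatrixAlgebra.
Variables (l : comPzRingType) (S : choiceType) (A : nualg l).
Implicit Types M N P : fsmod (S * S)%type A.

Definition matalg_mul_fun M N (st : S * S) : A :=
  \sum_(u \in [set: S]) M (st.1, u) *n N (u, st.2).

Lemma matalg_mul_finite M N : finite_set [set st | matalg_mul_fun M N st != 0].
Proof.
apply: (sub_finite_set _ (finite_image2 (fun a b : S * S => (a.1, b.2))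
  (fs_finite M) (fs_finite N))) => -[s t] /= h.
have [u hu] : exists u, M (s, u) *n N (u, t) != 0.
  apply: contrapT => /forallNP hu; move/negP: h; apply.
  by rewrite /matalg_mul_fun fsbig1 //= => u _; apply/eqP/negPn/negP.
exists (s, u) => /=; first by apply: contraNneq hu => ->; rewrite nu_0mul.
by exists (u, t) => //=; apply: contraNneq hu => ->; rewrite nu_mul0.
Qed.

Definition matalg_mul M N : fsmod (S * S)%type A := mkfs (matalg_mul_finite M N).

Lemma matalg_mulE M N s t :
  matalg_mul M N (s, t) = \sum_(u \in [set: S]) M (s, u) *n N (u, t).
Proof. by []. Qed.

Definition mat_covers (r : seq S) M :=
  forall s t, M (s, t) != 0 -> (s \in r) && (t \in r).

Lemma mat_cover M : exists r, mat_covers r M.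
Proof.
have [r _ Mr] := fs_seq M; exists (map fst r ++ map snd r) => s t /Mr st.
rewrite !mem_cat.
have /= -> := map_f fst st; have /= -> := map_f snd st; exact: orbT.
Qed.

Lemma mat_cover3 M N P :
  exists r, [/\ uniq r, mat_covers r M, mat_covers r N & mat_covers r P].
Proof.
have [a Ma] := mat_cover M; have [b Nb] := mat_cover N.
have [c Pc] := mat_cover P; exists (undup (a ++ b ++ c)).
split; first exact: undup_uniq.
- by move=> s t /Ma /andP[sa ta]; rewrite !mem_undup !mem_cat sa ta.
- by move=> s t /Nb /andP[sa ta]; rewrite !mem_undup !mem_cat sa ta !orbT.
- by move=> s t /Pc /andP[sa ta]; rewrite !mem_undup !mem_cat sa ta !orbT.
Qed.

Lemma matalg_mul_seql r M N s t : uniq r -> mat_covers r M ->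
  matalg_mul M N (s, t) = \sum_(u <- r) M (s, u) *n N (u, t).
Proof.
move=> ur Mr; rewrite matalg_mulE; apply: fsum_seq => // u hu.
suff /Mr/andP[] : M (s, u) != 0 by [].
by apply: contraNneq hu => ->; rewrite nu_0mul.
Qed.

Lemma matalg_mul_seqr r M N s t : uniq r -> mat_covers r N ->
  matalg_mul M N (s, t) = \sum_(u <- r) M (s, u) *n N (u, t).
Proof.
move=> ur Nr; rewrite matalg_mulE; apply: fsum_seq => // u hu.
suff /Nr/andP[] : N (u, t) != 0 by [].
by apply: contraNneq hu => ->; rewrite nu_mul0.
Qed.

Lemma matalg_mulA : associative matalg_mul.
Proof.
move=> M N P; apply: fsP => -[s t]; have [r [ur Mr Nr Pr]] := mat_cover3 M N P.
rewrite (matalg_mul_seql _ _ _ ur Mr) (matalg_mul_seqr _ _ _ ur Pr).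
under eq_bigr => u _ do rewrite (matalg_mul_seql _ _ _ ur Nr) nu_sumr.
under [RHS]eq_bigr => u _ do rewrite (matalg_mul_seqr _ _ _ ur Nr) nu_suml.
rewrite exchange_big; apply: eq_bigr => u _; apply: eq_bigr => v _.
exact: nu_mulA.
Qed.

Definition matalg : nualg l.
Proof.
apply: (@NUAlg l (fsmod (S * S)%type A) matalg_mul matalg_mulA).
- move=> M N P; apply: fsP => -[s t]; have [r [ur _ _ Pr]] := mat_cover3 M N P.
  rewrite fs_add !(matalg_mul_seqr _ _ _ ur Pr) -big_split.
  by apply: eq_bigr => u _; rewrite fs_add nu_mulDl.
- move=> M N P; apply: fsP => -[s t]; have [r [ur Mr _ _]] := mat_cover3 M N P.
  rewrite fs_add !(matalg_mul_seql _ _ _ ur Mr) -big_split.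
  by apply: eq_bigr => u _; rewrite fs_add nu_mulDr.
- move=> a M N; apply: fsP => -[s t]; have [r [ur _ Nr _]] := mat_cover3 M N N.
  rewrite fs_scale !(matalg_mul_seqr _ _ _ ur Nr) scaler_sumr.
  by apply: eq_bigr => u _; rewrite fs_scale nu_scaleAl.
- move=> a M N; apply: fsP => -[s t]; have [r [ur Mr _ _]] := mat_cover3 M N N.
  rewrite fs_scale !(matalg_mul_seql _ _ _ ur Mr) scaler_sumr.
  by apply: eq_bigr => u _; rewrite fs_scale nu_scaleAr.
Defined.

(* a |-> epsilon_{s,s} (x) a *)
Definition mat_corner (s : S) : nuhom A matalg.
Proof.
apply: (@NUHom l A matalg (fs_single (s, s) : {linear A -> matalg})) => x y /=.
apply: fsP => -[t t']; rewrite [RHS]matalg_mulE.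
rewrite (@fsum_seq _ _ [:: s]) // => [|u].
  rewrite big_seq1 !fs_singleE !xpair_eqE eqxx andbT /=.
  by case: eqP; case: eqP; rewrite ?nu_mul0 ?nu_0mul.
rewrite !fs_singleE !xpair_eqE inE.
by case: (u =P s) => // _; rewrite andbF nu_0mul eqxx.
Defined.

End MatrixAlgebra.

(* The quotient of the free associative algebra on X by the relations R is
   built in one step, as formal expressions modulo the smallest congruence
   containing R and the axioms of non-unital algebras; see [pres_lift]. *)

Inductive aterm (l X : Type) : Type :=
| AGen of X
| AZero
| AOpp of aterm l X
| AAdd of aterm l X & aterm l X
| AScale of l & aterm l X
| AMul of aterm l X & aterm l X.

Arguments AGen {l X}.
Arguments AZero {l X}.

HB.instance Definition _ (l X : Type) := gen_eqMixin (aterm l X).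
HB.instance Definition _ (l X : Type) := gen_choiceMixin (aterm l X).

Section Presentation.
Variables (l : comPzRingType) (X : Type) (R : aterm l X -> aterm l X -> Prop).
Implicit Types t u v : aterm l X.

Inductive acong : aterm l X -> aterm l X -> Prop :=
| acong_rel t u : R t u -> acong t u
| acong_refl t : acong t t
| acong_sym t u : acong t u -> acong u t
| acong_trans t u v : acong t u -> acong u v -> acong t v
| acong_opp t t' : acong t t' -> acong (AOpp t) (AOpp t')
| acong_add t t' u u' :
    acong t t' -> acong u u' -> acong (AAdd t u) (AAdd t' u')
| acong_scale a t t' : acong t t' -> acong (AScale a t) (AScale a t')
| acong_mul t t' u u' :
    acong t t' -> acong u u' -> acong (AMul t u) (AMul t' u')
| acong_addA t u v : acong (AAdd t (AAdd u v)) (AAdd (AAdd t u) v)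
| acong_addC t u : acong (AAdd t u) (AAdd u t)
| acong_add0 t : acong (AAdd AZero t) t
| acong_addN t : acong (AAdd (AOpp t) t) AZero
| acong_scaleA a b t : acong (AScale a (AScale b t)) (AScale (a * b) t)
| acong_scale1 t : acong (AScale 1 t) t
| acong_scaleDr a t u :
    acong (AScale a (AAdd t u)) (AAdd (AScale a t) (AScale a u))
| acong_scaleDl a b t :
    acong (AScale (a + b) t) (AAdd (AScale a t) (AScale b t))
| acong_mulA t u v : acong (AMul t (AMul u v)) (AMul (AMul t u) v)
| acong_mulDl t u v : acong (AMul (AAdd t u) v) (AAdd (AMul t v) (AMul u v))
| acong_mulDr t u v : acong (AMul t (AAdd u v)) (AAdd (AMul t u) (AMul t v))
| acong_scaleAl a t u : acong (AScale a (AMul t u)) (AMul (AScale a t) u)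
| acong_scaleAr a t u : acong (AScale a (AMul t u)) (AMul t (AScale a u)).

Definition acongb : rel (aterm l X) := fun t u => `[< acong t u >].

Lemma acongb_equiv : equiv_class_of acongb.
Proof.
split=> [t|t u|u t v]; first by apply/asboolP; exact: acong_refl.
  by apply/asboolP/asboolP; exact: acong_sym.
by move=> /asboolP tu /asboolP uv; apply/asboolP; exact: acong_trans uv.
Qed.

Canonical acongb_equivRel := EquivRelPack acongb_equiv.

Definition pres_sort := {eq_quot acongb}.

HB.instance Definition _ : EqQuotient _ acongb pres_sort := EqQuotient.on pres_sort.
HB.instance Definition _ := Choice.on pres_sort.

Definition pres_pi t : pres_sort := \pi_pres_sort t.

Lemma pres_piP t u : pres_pi t = pres_pi u <-> acong t u.
Proof.
split=> [/eqP|tu]; last apply/eqP; rewrite /pres_pi piE; first by move/asboolP.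
exact/asboolP.
Qed.

Lemma pres_ind (P : pres_sort -> Prop) : (forall t, P (pres_pi t)) -> forall x, P x.
Proof. by move=> h x; rewrite -[x]reprK; exact: h. Qed.

Lemma acong_repr t : acong (repr (pres_pi t)) t.
Proof. by apply/pres_piP; exact: reprK. Qed.

Definition pres_add (x y : pres_sort) := pres_pi (AAdd (repr x) (repr y)).
Definition pres_opp (x : pres_sort) := pres_pi (AOpp (repr x)).
Definition pres_scale (a : l) (x : pres_sort) := pres_pi (AScale a (repr x)).
Definition pres_mul (x y : pres_sort) := pres_pi (AMul (repr x) (repr y)).

Lemma pres_addE t u : pres_add (pres_pi t) (pres_pi u) = pres_pi (AAdd t u).
Proof. by apply/pres_piP/acong_add; exact: acong_repr. Qed.

Lemma pres_oppE t : pres_opp (pres_pi t) = pres_pi (AOpp t).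
Proof. by apply/pres_piP/acong_opp; exact: acong_repr. Qed.

Lemma pres_scaleE a t : pres_scale a (pres_pi t) = pres_pi (AScale a t).
Proof. by apply/pres_piP/acong_scale; exact: acong_repr. Qed.

Lemma pres_mulE t u : pres_mul (pres_pi t) (pres_pi u) = pres_pi (AMul t u).
Proof. by apply/pres_piP/acong_mul; exact: acong_repr. Qed.

Let presE := (pres_addE, pres_oppE, pres_scaleE, pres_mulE).

Lemma pres_addA : associative pres_add.
Proof.
elim/pres_ind=> t; elim/pres_ind=> u; elim/pres_ind=> v; rewrite !presE.
exact/pres_piP/acong_addA.
Qed.

Lemma pres_addC : commutative pres_add.
Proof.
elim/pres_ind=> t; elim/pres_ind=> u; rewrite !presE.
exact/pres_piP/acong_addC.
Qed.

Lemma pres_add0 : left_id (pres_pi AZero) pres_add.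
Proof. by elim/pres_ind=> t; rewrite !presE; exact/pres_piP/acong_add0. Qed.

Lemma pres_addN : left_inverse (pres_pi AZero) pres_opp pres_add.
Proof. by elim/pres_ind=> t; rewrite !presE; exact/pres_piP/acong_addN. Qed.

HB.instance Definition _ :=
  GRing.isZmodule.Build pres_sort pres_addA pres_addC pres_add0 pres_addN.

Lemma pres_scaleA a b x : pres_scale a (pres_scale b x) = pres_scale (a * b) x.
Proof. by elim/pres_ind: x => t; rewrite !presE; exact/pres_piP/acong_scaleA. Qed.

Lemma pres_scale1 : left_id 1 pres_scale.
Proof. by elim/pres_ind=> t; rewrite !presE; exact/pres_piP/acong_scale1. Qed.

Lemma pres_scaleDr : right_distributive pres_scale +%R.
Proof.
move=> a; elim/pres_ind=> t; elim/pres_ind=> u.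
by rewrite /GRing.add /= !presE; exact/pres_piP/acong_scaleDr.
Qed.

Lemma pres_scaleDl x : {morph pres_scale^~ x : a b / a + b}.
Proof.
move=> a b; elim/pres_ind: x => t.
by rewrite [in RHS]/GRing.add /= !presE; exact/pres_piP/acong_scaleDl.
Qed.

HB.instance Definition _ := GRing.Zmodule_isLmodule.Build l pres_sort
  pres_scaleA pres_scale1 pres_scaleDr pres_scaleDl.

Definition presalg : nualg l.
Proof.
apply: (@NUAlg l pres_sort pres_mul).
- elim/pres_ind=> t; elim/pres_ind=> u; elim/pres_ind=> v; rewrite !presE.
  exact/pres_piP/acong_mulA.
- elim/pres_ind=> t; elim/pres_ind=> u; elim/pres_ind=> v.
  by rewrite /GRing.add /= !presE; exact/pres_piP/acong_mulDl.
- elim/pres_ind=> t; elim/pres_ind=> u; elim/pres_ind=> v.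
  by rewrite /GRing.add /= !presE; exact/pres_piP/acong_mulDr.
- move=> a; elim/pres_ind=> t; elim/pres_ind=> u.
  by rewrite /GRing.scale /= !presE; exact/pres_piP/acong_scaleAl.
- move=> a; elim/pres_ind=> t; elim/pres_ind=> u.
  by rewrite /GRing.scale /= !presE; exact/pres_piP/acong_scaleAr.
Defined.

Definition pres_gen (x : X) : presalg := pres_pi (AGen x).

Fixpoint aeval (B : nualg l) (f : X -> B) (t : aterm l X) : B :=
  match t with
  | AGen x => f x
  | AZero => 0
  | AOpp u => - aeval f u
  | AAdd u v => aeval f u + aeval f v
  | AScale a u => a *: aeval f u
  | AMul u v => aeval f u *n aeval f v
  end.

Lemma aeval_acong (B : nualg l) (f : X -> B) :
  (forall t u, R t u -> aeval f t = aeval f u) ->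
  forall t u, acong t u -> aeval f t = aeval f u.
Proof.
move=> fR t u; elim=> {t u} //=; try by move=> *; congruence.
- by move=> t u v; rewrite addrA.
- by move=> t u; rewrite addrC.
- by move=> t; rewrite add0r.
- by move=> t; rewrite addNr.
- by move=> a b t; rewrite scalerA.
- by move=> t; rewrite scale1r.
- by move=> a t u; rewrite scalerDr.
- by move=> a b t; rewrite scalerDl.
- by move=> t u v; rewrite nu_mulA.
- by move=> t u v; rewrite nu_mulDl.
- by move=> t u v; rewrite nu_mulDr.
- by move=> a t u; rewrite nu_scaleAl.
- by move=> a t u; rewrite nu_scaleAr.
Qed.

Lemma aeval_pres_gen t : aeval pres_gen t = pres_pi t.
Proof.
elim: t => //= [u ->|u -> v ->|a u ->|u -> v ->].
- exact: pres_oppE.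
- exact: pres_addE.
- exact: pres_scaleE.
- exact: pres_mulE.
Qed.

Lemma pres_rel t u : R t u -> aeval pres_gen t = aeval pres_gen u.
Proof. by move=> tu; rewrite !aeval_pres_gen; apply/pres_piP/acong_rel. Qed.

Lemma aeval_hom (B : nualg l) (g : nuhom presalg B) t :
  g (pres_pi t) = aeval (fun x => g (pres_gen x)) t.
Proof.
elim: t => //= [|u <-|u <- v <-|a u <-|u <- v <-].
- exact: (linear0 g).
- by rewrite -linearN; congr (g _); rewrite -pres_oppE.
- by rewrite -linearD; congr (g _); rewrite -pres_addE.
- by rewrite -linearZ; congr (g _); rewrite -pres_scaleE.
- by rewrite -pres_mulE; exact: (nuhM g (pres_pi u) (pres_pi v)).
Qed.

Theorem pres_lift (B : nualg l) (f : X -> B) :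
  (forall t u, R t u -> aeval f t = aeval f u) ->
  exists! g : nuhom presalg B, forall x, g (pres_gen x) = f x.
Proof.
move=> fR; pose g (x : presalg) : B := aeval f (repr x).
have gE t : g (pres_pi t) = aeval f t.
  by apply: (aeval_acong fR); exact: acong_repr.
have gl : linear g.
  move=> a; elim/pres_ind=> t; elim/pres_ind=> u.
  rewrite /GRing.add /= /GRing.scale /= pres_scaleE pres_addE !gE //.
pose G : {linear presalg -> B} :=
  HB.pack g (GRing.isLinear.Build l presalg B *:%R g gl).
have GM (x y : presalg) : G (x *n y) = G x *n G y.
  elim/pres_ind: x => t; elim/pres_ind: y => u.
  by rewrite /nu_mul /= pres_mulE !gE.
exists (NUHom GM); split=> [x|h hf]; first exact: gE.
apply: nuhom_ext; elim/pres_ind=> t; rewrite [RHS]aeval_hom; apply: (etrans (gE t)).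
by congr (aeval _ t); apply: funext => x; rewrite hf.
Qed.

End Presentation.

(* By classical choice every type carries a choiceType structure, so this does
   not restrict the sets of vertices and edges. *)
Record digraph := Digraph {
  vert : choiceType;
  edge : choiceType;
  src : edge -> vert;
  rng : edge -> vert }.

Inductive cohn_gen (E : digraph) : Type :=
| CVert of vert E
| CEdge of edge E
| CGhost of edge E.

Section CohnPathAlgebra.
Variables (l : comPzRingType) (E : digraph).
Local Notation V v := (AGen (CVert v)).
Local Notation D e := (AGen (CEdge e)).
Local Notation G e := (AGen (CGhost e)).

Inductive cohn_rel : aterm l (cohn_gen E) -> aterm l (cohn_gen E) -> Prop :=
| cohn_vv (v : vert E) : cohn_rel (AMul (V v) (V v)) (V v)
| cohn_vw (v w : vert E) : v <> w -> cohn_rel (AMul (V v) (V w)) AZero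
| cohn_se (e : edge E) : cohn_rel (AMul (V (src e)) (D e)) (D e)
| cohn_er (e : edge E) : cohn_rel (AMul (D e) (V (rng e))) (D e)
| cohn_rg (e : edge E) : cohn_rel (AMul (V (rng e)) (G e)) (G e)
| cohn_gs (e : edge E) : cohn_rel (AMul (G e) (V (src e))) (G e)
| cohn_gee (e : edge E) : cohn_rel (AMul (G e) (D e)) (V (rng e))
| cohn_gef (e f : edge E) : e <> f -> cohn_rel (AMul (G e) (D f)) AZero.

Definition cohn : nualg l := presalg cohn_rel.

Definition cohn_vert (v : vert E) : cohn := pres_gen cohn_rel (CVert v).

Lemma cohn_vertM v w :
  cohn_vert v *n cohn_vert w = if v == w then cohn_vert v else 0.
Proof.
case: eqP => [<-|vw]; first exact: (pres_rel (cohn_vv v)).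
exact: (pres_rel (cohn_vw vw)).
Qed.

Definition cohn_phi_fun (f : funalg l (vert E)) : cohn :=
  \sum_(v \in [set: vert E]) (f v : l) *: cohn_vert v.

Lemma cohn_phi_seq (f : funalg l (vert E)) r : uniq r ->
  (forall v, f v != 0 -> v \in r) ->
  cohn_phi_fun f = \sum_(v <- r) (f v : l) *: cohn_vert v.
Proof.
move=> ur fr; apply: fsum_seq => // v hv; apply: fr.
by apply: contraNneq hv => ->; rewrite scale0r.
Qed.

Lemma fs_seq2 (f g : funalg l (vert E)) : exists r, [/\ uniq r,
  forall v, f v != 0 -> v \in r & forall v, g v != 0 -> v \in r].
Proof.
have [r _ fr] := fs_seq f; have [s _ gs] := fs_seq g.
exists (undup (r ++ s)); split; first exact: undup_uniq.
  by move=> v /fr vr; rewrite mem_undup mem_cat vr.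
by move=> v /gs vs; rewrite mem_undup mem_cat vs orbT.
Qed.

Lemma cohn_phi_linear : linear cohn_phi_fun.
Proof.
move=> a f g; have [r [ur fr gr]] := fs_seq2 f g.
rewrite (cohn_phi_seq ur fr) (cohn_phi_seq ur gr) (cohn_phi_seq ur); last first.
  move=> v hv; have [f0|/fr //] := eqVneq (f v) 0.
  by apply: gr; apply: contraNneq hv => g0; rewrite fs_add fs_scale f0 g0 scaler0 addr0.
rewrite scaler_sumr -big_split; apply: eq_bigr => v _ /=.
by rewrite scalerA -scalerDl.
Qed.

HB.instance Definition _ := GRing.isLinear.Build _ _ _ _ cohn_phi_fun cohn_phi_linear.

Lemma cohn_phiM (f g : funalg l (vert E)) :
  cohn_phi_fun (f *n g) = cohn_phi_fun f *n cohn_phi_fun g.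
Proof.
have [r [ur fr gr]] := fs_seq2 f g.
rewrite (cohn_phi_seq ur fr) (cohn_phi_seq ur gr) (cohn_phi_seq ur); last first.
  move=> v hv; apply: fr; apply: contraNneq hv => f0.
  by rewrite /nu_mul /= f0 mul0r.
rewrite nu_suml; apply: eq_big_seq => v vr; rewrite nu_sumr.
rewrite (bigD1_seq v) // -nu_scaleAl -nu_scaleAr cohn_vertM eqxx scalerA.
rewrite big1; first exact: (esym (addr0 _)).
move=> w wv.
by rewrite -nu_scaleAl -nu_scaleAr cohn_vertM eq_sym (negPf wv) !scaler0.
Qed.

Definition cohn_phi : nuhom (funalg l (vert E)) cohn :=
  @NUHom l _ _ (cohn_phi_fun : {linear _ -> _}) cohn_phiM.

Lemma cohn_phiE v : cohn_phi (chi l v) = cohn_vert v.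
Proof.
rewrite /= (@cohn_phi_seq _ [:: v]) // => [|w].
  by rewrite big_seq1 /chi fs_singleE eqxx scale1r.
by rewrite /chi fs_singleE inE; case: (w =P v) => // _ /negP[].
Qed.

End CohnPathAlgebra.

Record category := Category {
  ob :> Type;
  mor : ob -> ob -> Type;
  idm : forall a, mor a a;
  mcomp : forall a b c, mor b c -> mor a b -> mor a c;
  mcompA : forall a b c d (h : mor c d) (g : mor b c) (f : mor a b),
    mcomp h (mcomp g f) = mcomp (mcomp h g) f;
  mcomp1m : forall a b (f : mor a b), mcomp (idm b) f = f;
  mcompm1 : forall a b (f : mor a b), mcomp f (idm a) = f }.

Arguments idm {c} a : rename.

Notation "g \oc f" := (mcomp g f) : category_scope.

Definition Alg (l : comPzRingType) : category :=
  @Category (nualg l) (@nuhom l) (@nuid l) (@nucomp l)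
    (@nucompA l) (@nucomp1m l) (@nucompm1 l).

Definition is_iso (C : category) (a b : C) (f : mor a b) : Prop :=
  exists g : mor b a, g \oc f = idm a /\ f \oc g = idm b.

Record functor (C D : category) := Functor {
  fob :> C -> D;
  fmap : forall a b, mor a b -> mor (fob a) (fob b);
  fmap1 : forall a, fmap (idm a) = idm (fob a);
  fmapM : forall a b c (g : mor b c) (f : mor a b),
    fmap (g \oc f) = fmap g \oc fmap f }.

Definition functor_id (C : category) : functor C C :=
  @Functor C C id (fun _ _ f => f) (fun _ => erefl) (fun _ _ _ _ _ => erefl).

Definition functor_comp (C D K : category) (G : functor D K) (F : functor C D) :
  functor C K.
Proof.
apply: (@Functor C K (fun a => G (F a)) (fun a b f => fmap G (fmap F f))).
- by move=> a; rewrite !fmap1.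
- by move=> a b c g f; rewrite !fmapM.
Defined.

Record nat_iso (C D : category) (F G : functor C D) := NatIso {
  ni :> forall a, mor (F a) (G a);
  ni_natural : forall a b (f : mor a b), ni b \oc fmap F f = fmap G f \oc ni a;
  ni_iso : forall a, is_iso (ni a) }.

Definition is_equivalence (C D : category) (F : functor C D) : Prop :=
  exists G : functor D C,
    inhabited (nat_iso (functor_comp G F) (functor_id C)) /\
    inhabited (nat_iso (functor_comp F G) (functor_id D)).

Record additiveCat := AdditiveCat {
  aob : Type;
  ahom : aob -> aob -> zmodType;
  aid : forall a, ahom a a;
  acomp : forall a b c, ahom b c -> ahom a b -> ahom a c;
  acompA : forall a b c d (h : ahom c d) (g : ahom b c) (f : ahom a b),
    acomp h (acomp g f) = acomp (acomp h g) f;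
  acomp1m : forall a b (f : ahom a b), acomp (aid b) f = f;
  acompm1 : forall a b (f : ahom a b), acomp f (aid a) = f;
  acompDl : forall a b c (g g' : ahom b c) (f : ahom a b),
    acomp (g + g') f = acomp g f + acomp g' f;
  acompDr : forall a b c (g : ahom b c) (f f' : ahom a b),
    acomp g (f + f') = acomp g f + acomp g f';
  azero : exists z : aob, aid z = 0;
  abiprod : forall a b : aob, exists (p : aob)
    (ia : ahom a p) (ib : ahom b p) (pa : ahom p a) (pb : ahom p b),
    [/\ acomp pa ia = aid a, acomp pb ib = aid b, acomp pa ib = 0,
        acomp pb ia = 0 & acomp ia pa + acomp ib pb = aid p] }.

Definition category_of_additive (T : additiveCat) : category :=
  @Category (aob T) (fun a b => ahom a b : Type) (@aid T) (@acomp T)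
    (@acompA T) (@acomp1m T) (@acompm1 T).

Coercion category_of_additive : additiveCat >-> category.

Definition additive_functor (S T : additiveCat) (F : functor S T) : Prop :=
  forall (a b : aob S) (f g : ahom a b),
    fmap F (f + g : ahom a b) = (fmap F f + fmap F g : ahom (F a) (F b)).

(* The distinguished triangles Omega c --h--> a --f--> b --g--> c of a category
   with inverse suspension Omega. *)
Definition triangle_pred (T : additiveCat) (Om : functor T T) :=
  forall a b c : T, mor (Om c) a -> mor a b -> mor b c -> Prop.

(* Verdier's axioms, including the octahedron, for the opposite category with
   suspension Omega: reversing the arrows turns a triangle below into
   c -> b -> a -> Omega c.  This fixes the signs. *)
Record is_triangulated (T : additiveCat) (Om : functor T T)
    (dist : triangle_pred Om) : Prop := IsTriangulated {
  tr_additive : additive_functor Om;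
  tr_equivalence : is_equivalence Om;
  tr_iso : forall (a b c a' b' c' : T)
      (h : mor (Om c) a) (f : mor a b) (g : mor b c)
      (h' : mor (Om c') a') (f' : mor a' b') (g' : mor b' c')
      (u : mor a a') (v : mor b b') (w : mor c c'),
    is_iso u -> is_iso v -> is_iso w ->
    u \oc h = h' \oc fmap Om w -> v \oc f = f' \oc u -> w \oc g = g' \oc v ->
    dist a b c h f g -> dist a' b' c' h' f' g';
  tr_id : forall z c : T, idm z = (0 : ahom z z) ->
    dist z c c (0 : ahom (Om c) z) (0 : ahom z c) (idm c);
  tr_fiber : forall (b c : T) (g : mor b c),
    exists (a : T) (h : mor (Om c) a) (f : mor a b), dist a b c h f g;
  tr_rotate : forall (a b c : T) (h : mor (Om c) a) (f : mor a b) (g : mor b c),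
    dist a b c h f g <->
    dist (Om c) a b (- (fmap Om g : ahom (Om b) (Om c))) h f;
  tr_complete : forall (a b c a' b' c' : T)
      (h : mor (Om c) a) (f : mor a b) (g : mor b c)
      (h' : mor (Om c') a') (f' : mor a' b') (g' : mor b' c')
      (v : mor b b') (w : mor c c'),
    dist a b c h f g -> dist a' b' c' h' f' g' -> w \oc g = g' \oc v ->
    exists u : mor a a', u \oc h = h' \oc fmap Om w /\ v \oc f = f' \oc u;
  tr_octahedron : forall (b c d x y z : T) (g : mor b c) (k : mor c d)
      (hx : mor (Om c) x) (fx : mor x b)
      (hy : mor (Om d) y) (fy : mor y c)
      (hz : mor (Om d) z) (fz : mor z b),
    dist x b c hx fx g -> dist y c d hy fy k -> dist z b d hz fz (k \oc g) ->
    exists (p : mor x z) (q : mor z y),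
      [/\ dist x z y (hx \oc fmap Om fy) p q,
          fz \oc p = fx, p \oc hx = hz \oc fmap Om k,
          fy \oc q = g \oc fz & q \oc hz = hy] }.

Record triCat := TriCat {
  tri_add :> additiveCat;
  Omega : functor tri_add tri_add;
  dist : triangle_pred Omega;
  triP : is_triangulated dist }.

Arguments Omega {t} : rename.
Arguments dist {t a b c} : rename.

(* Omega is an equivalence but not an automorphism, so a triangulated functor
   carries the isomorphism [tf_omega] : Omega G -> G Omega. *)
Record triFunctor (S T : triCat) := TriFunctor {
  tf_functor :> functor S T;
  tf_omega : nat_iso (functor_comp Omega tf_functor)
                     (functor_comp tf_functor Omega);
  tf_additive : additive_functor tf_functor;
  tf_dist : forall (a b c : S) (h : mor (Omega c) a) (f : mor a b) (g : mor b c),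
    dist h f g ->
    dist (fmap tf_functor h \oc tf_omega c) (fmap tf_functor f)
         (fmap tf_functor g) }.

Record extension (l : comPzRingType) := Extension {
  ext_ker : nualg l;
  ext_mid : nualg l;
  ext_quo : nualg l;
  ext_inj : nuhom ext_ker ext_mid;
  ext_proj : nuhom ext_mid ext_quo;
  ext_injective : injective ext_inj;
  ext_surjective : forall c, exists b, ext_proj b = c;
  ext_exact : forall b, ext_proj b = 0 <-> exists a, ext_inj a = b;
  ext_split : exists s : {linear ext_quo -> ext_mid}, cancel s ext_proj }.

Record ext_morph (l : comPzRingType) (e e' : extension l) := ExtMorph {
  em_ker : nuhom (ext_ker e) (ext_ker e');
  em_mid : nuhom (ext_mid e) (ext_mid e');
  em_quo : nuhom (ext_quo e) (ext_quo e');
  em_inj : forall a, em_mid (ext_inj e a) = ext_inj e' (em_ker a);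
  em_proj : forall b, em_quo (ext_proj e b) = ext_proj e' (em_mid b) }.

(* Only the data of an excisive homology theory; the axioms on the connecting
   maps are in [excisive]. *)
Record boundary_theory (l : comPzRingType) (T : triCat) := BoundaryTheory {
  bt_functor :> functor (Alg l) T;
  bt_bd : forall e : extension l,
    mor (Omega (bt_functor (ext_quo e))) (bt_functor (ext_ker e)) }.

Section HomologyTheory.
Variables (l : comPzRingType) (T : triCat) (X : boundary_theory l T).

Definition excisive : Prop :=
  (forall e : extension l,
    dist (bt_bd X e) (fmap X (ext_inj e : mor (_ : Alg l) _))
                     (fmap X (ext_proj e : mor (_ : Alg l) _))) /\
  (forall (e e' : extension l) (m : ext_morph e e'),
    fmap X (em_ker m : mor (_ : Alg l) _) \oc bt_bd X e =
    bt_bd X e' \oc fmap Omega (fmap X (em_quo m : mor (_ : Alg l) _))).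

Definition homotopy_invariant : Prop :=
  forall A : nualg l, is_iso (fmap X (polyalg_const A : mor (_ : Alg l) _)).

Definition matrix_stable (S : choiceType) : Prop :=
  forall (A : nualg l) (s : S),
    is_iso (fmap X (mat_corner A s : mor (_ : Alg l) _)).

Definition graph_stable (E : digraph) : Prop :=
  matrix_stable (vert E + edge E + nat)%type.

End HomologyTheory.

Definition bt_push (l : comPzRingType) (S T : triCat) (G : triFunctor S T)
    (X : boundary_theory l S) : boundary_theory l T :=
  @BoundaryTheory l T (functor_comp G X)
    (fun e => fmap G (bt_bd X e) \oc tf_omega G (X (ext_quo e))).

(* A morphism X -> Y of excisive theories is a triangulated functor G with
   [bt_push G X = Y], which says both G X = Y and compatibility with the
   connecting maps. *)
Definition universal_theory (l : comPzRingType) (E : digraph) (kk : triCat)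
    (j : boundary_theory l kk) : Prop :=
  [/\ excisive j, homotopy_invariant j, graph_stable j E &
    forall (T : triCat) (Y : boundary_theory l T),
      excisive Y -> homotopy_invariant Y -> graph_stable Y E ->
      exists! G : triFunctor kk T, bt_push G j = Y].

(* Main.v *)
Require Import Defs.
From HB Require Import structures.
From mathcomp Require Import all_boot all_algebra.
From mathcomp Require Import boolp classical_sets functions cardinality fsbigop.

(** Let S be the index set of the stability hypothesis.  Finite lists of edges
    embed in S, so C(E) acts on M_S(A), for every A, by rho_0: the Fock
    representation with the empty path removed from its basis.  In the
    semidirect product of C(E) and M_S(A), adding suitable entries at the empty
    path gives a second copy of C(E), so that families (p, a, b, a', b') in A
    define quasi-homomorphisms from C(E) to M_S(A):
      v |-> rho_0(v) + p_v at (0,0),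
      e |-> rho_0(e) + a_e at (e,0) + b_e at (0,0),
      g |-> rho_0(g) + a'_e at (0,e) + b'_e at (0,0), where g is the ghost of e.
    For A = l^(E^0), p = chi, a = a' = chi_r and b = b' = 0, the class q of
    this quasi-homomorphism satisfies q j(phi) = j(corner).  Its image in
    M_S(C(E)) has a = a' = r, b = b' = 0.  The relations are affine in (a, b)
    for fixed (a', b') and conversely, so three linear homotopies
    (r,0;r,0) -> (r,e;r,0) -> (r,e;0,g) -> (0,e;0,g) carry it to the
    quasi-homomorphism rho_0 + corner, whose class is j(corner).  Hence j(phi)
    has a left and a right inverse. *)

Set Implicit Arguments.
Unset Strict Implicit.
Unset Printing Implicit Defensive.

Import GRing.Theory.
Local Open Scope ring_scope.
Local Open Scope classical_set_scope.
Local Open Scope nualg_scope.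
Local Open Scope category_scope.

(** * Finite lists over an infinite set embed in it *)

Section ListsEmbed.

(** Comparability of cardinals. Zorn's lemma yields a maximal partial injection from [A] to [B]; if
    it missed both a point of [A] and a point of [B], that pair could be added to it. *)
Lemma partial_injection_total (S : Type) (A B : set S) :
  (exists k : S -> S, {in A &, injective k} /\ forall x, A x -> B (k x)) \/
  (exists k : S -> S, {in B &, injective k} /\ forall y, B y -> A (k y)).
Proof.
pose P := [set G : set (S * S) | [/\ forall x y, G (x, y) -> A x /\ B y,
  forall x y y', G (x, y) -> G (x, y') -> y = y' &
  forall x x' y, G (x, y) -> G (x', y) -> x = x']].
have [F FP Ftot|G [[GAB Gf Gi] Gmax]] := @Zorn_bigcup _ P.
  have dir G G' : F G -> F G' -> exists H, [/\ F H, G `<=` H & G' `<=` H].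
    by move=> FG FG'; case: (Ftot _ _ FG FG') => h; [exists G'|exists G]; split.
  split=> [x y [G /FP[h _ _]]|x y y' [G FG Gxy] [G' FG' Gxy']|].
  - exact: h.
  - have [H [FH /(_ _ Gxy) a /(_ _ Gxy') b]] := dir _ _ FG FG'.
    by have [_ h _] := FP _ FH; apply: h a b.
  - move=> x x' y [G FG Gxy] [G' FG' Gxy'].
    have [H [FH /(_ _ Gxy) a /(_ _ Gxy') b]] := dir _ _ FG FG'.
    by have [_ _ h] := FP _ FH; apply: h a b.
have [tA|/existsNP[a /not_implyP[Aa na]]] :=
    pselect (forall x, A x -> exists y, G (x, y)).
  left; have /choice[k kP] : forall x, exists y, A x -> G (x, y).
    move=> x; have [/tA[y xy]|nx] := pselect (A x); first by exists y.
    by exists x => /nx.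
  exists k; split=> [x x' /set_mem Ax /set_mem Ax' e|x /kP/GAB[]//].
  by apply: Gi (kP _ Ax) _; rewrite e; exact: kP.
have [tB|/existsNP[b /not_implyP[Bb nb]]] :=
    pselect (forall y, B y -> exists x, G (x, y)).
  right; have /choice[k kP] : forall y, exists x, B y -> G (x, y).
    move=> y; have [/tB[x xy]|ny] := pselect (B y); first by exists x.
    by exists y => /ny.
  exists k; split=> [y y' /set_mem By /set_mem By' e|y /kP/GAB[]//].
  by apply: Gf (kP _ By) _; rewrite e; exact: kP.
exfalso; apply: (Gmax (G `|` [set (a, b)])).
  by split=> [z Gz|e]; [left|apply: na; exists b; apply: e; right].
split=> [x y [/GAB//|[-> ->]]//|x y y'|x x' y].
- move=> [Gxy|[xa ->]] [Gxy'|[xa' ->]] //; first exact: Gf Gxy Gxy'.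
    by case: na; exists y; rewrite -xa'.
  by case: na; exists y'; rewrite -xa.
- move=> [Gxy|[-> yb]] [Gxy'|[-> yb']] //; first exact: Gi Gxy Gxy'.
    by case: nb; exists x; rewrite -yb'.
  by case: nb; exists x'; rewrite -yb.
Qed.

Variable S : choiceType.
Implicit Types (A : set S) (s : seq S).

Definition lists A : set (seq S) := [set s | forall x, x \in s -> A x].

Definition lists_embedding A (f : seq S -> S) :=
  {in lists A &, injective f} /\ (forall s, lists A s -> A (f s)).

Lemma lists1 A x : lists A [:: x] <-> A x.
Proof.
split=> [|Ax y]; first by apply; rewrite inE.
by rewrite inE => /eqP->.
Qed.

(* [seq A'] embeds in [seq (seq A)] through [h], hence in [seq A] and in [A]. *)
Lemma lists_embedding_extend A A' f (h : S -> seq S) :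
  lists_embedding A f -> {in A' &, injective h} ->
  (forall x, A' x -> lists A (h x)) ->
  {in lists A' &, injective (fun s => f (map (f \o h) s))} /\
  forall s, lists A' s -> A (f (map (f \o h) s)).
Proof.
move=> [fi fA] hi hA.
have hs s : lists A' s -> lists A (map (f \o h) s).
  by move=> As y /mapP[x /As Ax ->]; apply/fA/hA.
split=> [s s' /set_mem As /set_mem As' /fi e|s /hs/fA//].
have {e} : map (f \o h) s = map (f \o h) s' by apply: e; apply/mem_set/hs.
elim: s s' As As' => [|x s IH] [|x' s'] //= As As' [e es].
have Ax : A' x by apply: As; rewrite inE eqxx.
have Ax' : A' x' by apply: As'; rewrite inE eqxx.
congr cons.
  by apply: hi (fi _ _ _ _ e); apply/mem_set => //; apply: hA.
by apply: IH es => y ys; [apply: As|apply: As']; rewrite inE ys orbT.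
Qed.

(** Points of [A] become lists of length one and points of [B] lists of length two, so that the
    length separates the two images. *)
Lemma lists_double_embedding A (B : set S) (k : S -> S) :
  (forall x, B x -> ~ A x) -> {in B &, injective k} ->
  (forall x, B x -> A (k x)) ->
  exists h : S -> seq S, {in A `|` B &, injective h} /\
    forall x, (A `|` B) x -> lists A (h x).
Proof.
move=> dAB ki kA.
exists (fun x => if pselect (A x) then [:: x] else [:: k x; k x]); split.
  move=> x y /set_mem xAB /set_mem yAB.
  case: pselect => Ax; case: pselect => Ay => // -[] // kxy _.
  case: xAB => // Bx; case: yAB => // By.
  by apply: ki kxy; apply/mem_set.
move=> x xAB; case: pselect => Ax; first by apply/lists1.
case: xAB => // Bx y; rewrite !inE orbb => /eqP->; exact: kA.
Qed.

(** A set together with an embedding of its lists is recorded as one graph, and the set is recovered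
    from the one-element lists. Extending an embedding then means enlarging a graph, the order in
    which Zorn's lemma is applied. *)
Definition graph_dom (G : set (seq S * S)) : set S :=
  [set x | exists y, G ([:: x], y)].

Definition graph_embedding (G : set (seq S * S)) :=
  [/\ forall s x, G (s, x) -> lists (graph_dom G) s /\ graph_dom G x,
      forall s, lists (graph_dom G) s -> exists x, G (s, x),
      forall s x y, G (s, x) -> G (s, y) -> x = y &
      forall s t x, G (s, x) -> G (t, x) -> s = t].

Lemma graph_embedding_fun G : graph_embedding G -> exists f,
  lists_embedding (graph_dom G) f /\
  forall s, lists (graph_dom G) s -> G (s, f s).
Proof.
move=> [G1 G2 G3 G4].
(* Choice needs a default value in [S]. There is one, because [[::]] is a list over any set and
   hence has an image. *)
have [[x0]|S0] := pselect (inhabited S); last first.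
  have e s : s = [::] by case: s => // x; case: S0.
  have [x _] : exists x, G ([::], x) by apply: G2.
  by case: S0.
have /choice[f fP] : forall s, exists x, lists (graph_dom G) s -> G (s, x).
  move=> s; have [/G2[x sx]|ns] := pselect (lists (graph_dom G) s).
    by exists x.
  by exists x0 => /ns.
exists f; split=> //; split=> [s t /set_mem As /set_mem At e|s /fP/G1[]//].
by apply: G4 (fP _ As) _; rewrite e; exact: fP.
Qed.

Lemma fun_graph_embedding A f : lists_embedding A f ->
  graph_embedding [set p | lists A p.1 /\ p.2 = f p.1].
Proof.
set G := [set p | _] => -[fi fA].
have GA : graph_dom G = A.
  apply/seteqP; split=> [x [y [/lists1]]//|x Ax].
  by exists (f [:: x]); split=> //=; apply/lists1.
rewrite /graph_embedding GA; split=> [s x [/= As ->]|s As|s x y|s t x] //.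
- by split=> //; apply: fA.
- by exists (f s).
- by move=> [_ /= ->] [_ /= ->].
- by move=> [/= As ->] [/= At] /fi; apply; apply/mem_set.
Qed.

(** Zorn's lemma gives a maximal embedding of the lists over some [A] into [A], and [A] is compared
    with its complement. If the complement injects into [A], all lists over [S] embed in [A]; if [A]
    injects into its complement, the embedding extends properly. *)
Lemma seq_embedding (i : nat -> S) : injective i ->
  exists f : seq S -> S, injective f.
Proof.
(* The starting point: lists over the countable set [range i], coded by [pickle]. *)
move=> ii; pose G0 : set (seq S * S) :=
  [set p | exists t : seq nat, p = (map i t, i (pickle t))].
have pi0 : injective (fun t : seq nat => i (pickle t)).
  by move=> t u /ii/(pcan_inj pickleK).
have G0x : graph_dom G0 = range i.
  apply/seteqP; split=> [x [y [[//|n [|//]] [-> _]]]|x [n _ <-]].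
    by exists n.
  by exists (i (pickle [:: n])); exists [:: n].
have G0P : graph_embedding G0.
  rewrite /graph_embedding G0x; split=> [s x [t [-> ->]]|s si|s x y|s t x].
  - split; last by exists (pickle t).
    by move=> y /mapP[n _ ->]; exists n.
  - have [t ->] : exists t, s = map i t.
      elim: s si => [|x s IH] si; first by exists [::].
      have [n _ <-] : range i x by apply: si; rewrite inE eqxx.
      have [|t ->] := IH; last by exists (n :: t).
      by move=> y ys; apply: si; rewrite inE ys orbT.
    by exists (i (pickle t)); exists t.
  - by move=> [t [-> ->]] [u [/(inj_map ii) -> ->]].
  - by move=> [t' [-> ->]] [u' [-> /pi0 ->]].
(* The union with [G0] lets the empty chain satisfy [P] and keeps the domain nonempty. *)
pose P : set (set (seq S * S)) := [set G | graph_embedding (G `|` G0)].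
have [F FP Ftot|G [GP Gmax]] := @Zorn_bigcup _ P.
  have [[G1 FG1]|F0] := pselect (exists G, F G); last first.
    rewrite /P /= (_ : \bigcup_(X in F) X = set0) ?set0U //.
    by apply/seteqP; split=> // x [G FG]; case: F0; exists G.
  rewrite /P /=; set U := _ `|` G0.
  have sub G : F G -> G `|` G0 `<=` U.
    by move=> FG x [Gx|]; [left; exists G|right].
  have domS G H : G `<=` H -> graph_dom G `<=` graph_dom H.
    by move=> GH x [y /GH xy]; exists y.
  have inU p : U p -> exists2 G, F G & (G `|` G0) p.
    by move=> [[G FG Gp]|p0]; [exists G => //; left|exists G1 => //; right].
  have dir G G' : F G -> F G' -> exists H,
      [/\ F H, G `|` G0 `<=` H `|` G0 & G' `|` G0 `<=` H `|` G0].
    by move=> FG FG'; case: (Ftot _ _ FG FG') => h; [exists G'|exists G];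
      split=> //; apply: setSU.
  split=> [s x /inU[G FG Gsx]|s|s x y /inU[G FG a] /inU[H FH b]|
           s t x /inU[G FG a] /inU[H FH b]].
  - have [h _ _ _] := FP _ FG; have [ls dx] := h _ _ Gsx.
    split; last exact: domS (sub _ FG) _ dx.
    by move=> y /ls; apply: domS; exact: sub.
  - move=> ls; have [G FG lG] : exists2 G, F G & lists (graph_dom (G `|` G0)) s.
      elim: s ls => [|x s IH] ls; first by exists G1.
      have [|G FG lG] := IH; first by move=> y ys; apply: ls; rewrite inE ys orbT.
      have [|y /inU[G' FG' xy]] := ls x; first by rewrite inE eqxx.
      have [H [FH GH G'H]] := dir _ _ FG FG'.
      exists H => // z; rewrite inE => /orP[/eqP->|/lG]; last exact: domS.
      by exists y; apply: G'H.
    have [_ h _ _] := FP _ FG; have [x sx] := h _ lG.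
    by exists x; apply: sub sx.
  - have [K [FK GK HK]] := dir _ _ FG FH; have [_ _ h _] := FP _ FK.
    by apply: h (GK _ a) (HK _ b).
  - have [K [FK GK HK]] := dir _ _ FG FH; have [_ _ _ h] := FP _ FK.
    by apply: h (GK _ a) (HK _ b).
pose K := G `|` G0; pose A := graph_dom K.
have [f [fP fK]] := graph_embedding_fun GP; rewrite -/K -/A in fP fK.
(* The case treated first is that of the complement injecting into [A]: then [S] injects into the
   lists over [A]. *)
have [[k [ki kB]]|[k [ki kA]]] := @partial_injection_total S A (~` A); last first.
  have [h [hi hA]] := @lists_double_embedding A (~` A) k (fun _ p => p) ki kA.
  rewrite setUv in hi hA.
  have [gi _] := lists_embedding_extend fP hi hA.
  by exists (fun s => f (map (f \o h) s)) => s t; apply: gi; apply/mem_set.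
have [a Aa] : exists a, A a.
  exists (i 0%N); exists (i (pickle [:: 0%N])); right; by exists [:: 0%N].
have /choice[k' k'P] : forall y, exists x, (k @` A) y -> A x /\ k x = y.
  move=> y; have [[x Ax <-]|ny] := pselect ((k @` A) y); first by exists x.
  by exists y => /ny.
have [|||h [hi hA]] := @lists_double_embedding A (k @` A) k'.
- by move=> _ [x Ax <-]; apply: kB.
- move=> x y /set_mem Bx /set_mem By e.
  by rewrite -(k'P _ Bx).2 -(k'P _ By).2 e.
- by move=> x Bx; have [] := k'P _ Bx.
have [gi gA] := lists_embedding_extend fP hi hA.
set g := (fun s => f _) in gi gA; pose A' := A `|` k @` A.
(* For lists not entirely in [A], [k] moves the value out of [A], away from the values of [f]. *)
pose f' s := if pselect (lists A s) then f s else k (g s).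
have f'P : lists_embedding A' f'.
  split=> [s t /set_mem ls /set_mem lt|s ls]; rewrite /f'; last first.
    case: pselect => [As|nAs] /=; first by left; apply: fP.2.
    by right; exists (g s) => //; apply: gA.
  case: pselect => As /=; case: pselect => At /= e.
  - by apply: fP.1 e; apply/mem_set.
  - by case: (kB _ (gA _ lt)); rewrite -e; apply: fP.2.
  - by case: (kB _ (gA _ ls)); rewrite e; apply: fP.2.
  - by apply: gi; rewrite ?inE//; apply: ki e; apply/mem_set/gA.
exfalso; have KG' s x : K (s, x) -> lists A' s /\ x = f' s.
  have [h1 _ h3 _] := GP; move=> sx; have [ls _] := h1 _ _ sx.
  split; first by move=> y /ls; left.
  by rewrite /f'; case: pselect => //= ?; apply: h3 sx (fK _ ls).
apply: (Gmax [set p | lists A' p.1 /\ p.2 = f' p.1]); last first.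
  rewrite /P /= setUidl; first exact: fun_graph_embedding.
  by move=> [s x] sx; apply: KG'; right.
split=> [[s x] sx|e]; first by apply: KG'; left.
(* The extension is proper: if its graph were contained in [G], then [k a] would lie in [A]. *)
apply: (kB _ Aa); exists (f' [:: k a]); left; apply: e; split=> //=.
by apply/lists1; right; exists a.
Qed.

End ListsEmbed.

(** * Triangulated categories *)

Section Triangulated.
Variable T : triCat.
Implicit Types a b c z : T.
Local Notation hom x y := (@ahom (tri_add T) x y) (only parsing).
Local Notation "g \oc f" :=
  (@mcomp (category_of_additive (tri_add T)) _ _ _ g f) : category_scope.

Let trT := triP T.

Lemma mcomp0r a b c (g : hom b c) : g \oc (0 : hom a b) = (0 : hom a c).
Proof. by apply: (addrI (g \oc (0 : hom a b) : hom a c)); rewrite -[LHS]acompDr !addr0. Qed.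

Lemma mcomp0l a b c (f : hom a b) : (0 : hom b c) \oc f = (0 : hom a c).
Proof. by apply: (addrI ((0 : hom b c) \oc f : hom a c)); rewrite -[LHS]acompDl !addr0. Qed.

Lemma mcompDr a b c (g : hom b c) (f f' : hom a b) :
  g \oc (f + f' : hom a b) = (g \oc f : hom a c) + (g \oc f' : hom a c).
Proof. exact: acompDr. Qed.

Lemma mcompDl a b c (g g' : hom b c) (f : hom a b) :
  (g + g' : hom b c) \oc f = (g \oc f : hom a c) + (g' \oc f : hom a c).
Proof. exact: acompDl. Qed.

Lemma mcompNr a b c (g : hom b c) (f : hom a b) :
  g \oc (- f : hom a b) = - (g \oc f : hom a c).
Proof. by apply: (addrI (g \oc f : hom a c)); rewrite -mcompDr !subrr mcomp0r. Qed.

Lemma mcompNl a b c (g : hom b c) (f : hom a b) :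
  (- g : hom b c) \oc f = - (g \oc f : hom a c).
Proof. by apply: (addrI (g \oc f : hom a c)); rewrite -mcompDl !subrr mcomp0l. Qed.

Lemma Omega0 a b : fmap Omega (0 : hom a b) = (0 : hom (Omega a) (Omega b)).
Proof.
apply: (addrI (fmap Omega (0 : hom a b) : hom (Omega a) (Omega b))).
by rewrite -(tr_additive trT) !addr0.
Qed.

(** The pair of [g] and [idm c] completes to a morphism into the triangle on [idm c], whose fiber
    [z] is zero; so the composite factors through a zero arrow. *)
Lemma dist_comp0 a b c (h : hom (Omega c) a) (f : hom a b) (g : hom b c) :
  dist h f g -> g \oc f = (0 : hom a c).
Proof.
move=> d; have [z z0] := azero T.
have [|u [_ e]] := tr_complete trT (v := g) (w := idm c) d (tr_id trT c z0) _.
  by rewrite mcomp1m.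
by rewrite e mcomp0l.
Qed.

(** Exactness at [b]. A rotated identity triangle has the form [y -> y -> z] with [z] zero; the pair
    of [k] and [0] maps it to the given triangle, and the completing arrow is [k']. *)
Lemma dist_lift a b c (h : hom (Omega c) a) (f : hom a b) (g : hom b c)
    y (k : hom y b) :
  dist h f g -> g \oc k = (0 : hom y c) -> exists k' : hom y a, f \oc k' = k.
Proof.
move=> d gk; have [z z0] := azero T.
have Oz0 : @idm T (Omega z) = (0 : hom (Omega z) (Omega z)).
  by rewrite -fmap1 [@idm T z]z0; exact: Omega0.
have dy : @dist T y y z (0 : hom (Omega z) y) (@idm T y) (0 : hom y z).
  apply/(tr_rotate trT); rewrite Omega0 oppr0.
  exact: (tr_id trT y Oz0).
have [|u [_ e]] := tr_complete trT (v := k) (w := 0 : hom z c) dy d _.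
  by rewrite mcomp0l gk.
by exists u; rewrite -e [LHS]mcompm1.
Qed.

(** By exactness at [a], an arrow killed by [f] factors through [h]. But [h] vanishes, since its
    composite with [fmap Omega g] is zero and [fmap Omega g] has a section. *)
Lemma dist_mono a b c (h : hom (Omega c) a) (f : hom a b) (g : hom b c)
    (s : hom c b) y (k : hom y a) :
  dist h f g -> g \oc s = idm c -> f \oc k = (0 : hom y b) -> k = 0.
Proof.
move=> d gs fk.
have /(tr_rotate trT) d1 := d; have /(tr_rotate trT) d2 := d1.
have [k' <-] := dist_lift d1 fk.
have : (h : hom _ _) \oc fmap Omega g = (0 : hom _ _).
  have := dist_comp0 d2.
  by rewrite mcompNr => /eqP; rewrite oppr_eq0 => /eqP.
move=> hg; suff -> : h = 0 by rewrite mcomp0l.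
by rewrite -(@mcompm1 T _ _ h) -fmap1 -gs fmapM mcompA hg mcomp0l.
Qed.

End Triangulated.

(** * Semidirect products *)

Definition mknuhom (l : comPzRingType) (A B : nualg l) (f : A -> B)
    (fl : linear f) (fM : forall x y, f (x *n y) = f x *n f y) : nuhom A B :=
  @NUHom l A B (HB.pack f (GRing.isLinear.Build l A B *:%R f fl)) fM.

Definition nuzero (l : comPzRingType) (A B : nualg l) : nuhom A B.
Proof.
apply: (@mknuhom l A B (fun=> 0)) => [a x y|x y].
  by rewrite scaler0 addr0.
by rewrite nu_mul0.
Defined.

Section Endomorphisms.
Variables (l : comPzRingType) (V : lmodType l).

Definition linear_fun : {pred V -> V} := [pred f | `[< linear f >]].

Record endo := Endo { endo_fun :> V -> V; _ : endo_fun \in linear_fun }.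

HB.instance Definition _ := [isSub for endo_fun].
HB.instance Definition _ := [Choice of endo by <:].

Lemma linear_fun_submod_closed : submod_closed linear_fun.
Proof.
split=> [|a f g].
  by rewrite inE => b u v; rewrite /GRing.zero /= scaler0 addr0.
rewrite !inE => fl gl b u v.
change (a *: f (b *: u + v) + g (b *: u + v) =
  b *: (a *: f u + g u) + (a *: f v + g v)).
rewrite fl gl !scalerDr !scalerA.
by rewrite (mulrC a b) addrACA.
Qed.

HB.instance Definition _ :=
  GRing.isSubmodClosed.Build _ _ linear_fun linear_fun_submod_closed.
HB.instance Definition _ := [SubChoice_isSubLmodule of endo by <:].

Lemma endoP (f g : endo) : f =1 g -> f = g.
Proof. by move=> fg; apply: val_inj; apply: funext. Qed.

Lemma endo_linear (f : endo) : linear f.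
Proof. by have := valP f; rewrite inE. Qed.

HB.instance Definition _ (f : endo) :=
  GRing.isLinear.Build l V V *:%R f (endo_linear f).

Definition mkendo (f : V -> V) (fl : linear f) : endo := @Endo f (asboolT fl).

Lemma endo_comp_linear (f g : endo) : linear (f \o g).
Proof. by move=> a u v /=; rewrite !linearP. Qed.

Definition endalg : nualg l.
Proof.
apply: (@NUAlg l endo (fun f g => mkendo (endo_comp_linear f g))).
- by move=> f g h; apply: endoP.
- by move=> f g h; apply: endoP.
- by move=> f g h; apply: endoP => x /=; rewrite [LHS]linearD.
- by move=> a f g; apply: endoP.
- by move=> a f g; apply: endoP => x /=; rewrite [RHS]linearZ.
Defined.

End Endomorphisms.

Definition opalg (l : comPzRingType) (A : nualg l) : nualg l.
Proof.
apply: (@NUAlg l A (fun x y => y *n x)).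
- by move=> x y z; rewrite nu_mulA.
- by move=> x y z; rewrite nu_mulDr.
- by move=> x y z; rewrite nu_mulDl.
- by move=> a x y; rewrite nu_scaleAr.
- by move=> a x y; rewrite nu_scaleAl.
Defined.

(** Multiplication of [I] by elements of [B] on both sides, as for an ideal in an algebra that
    contains [B]. The right action reverses composition, hence [opalg]; the four compatibilities
    serve the associativity of [semidirect]. *)
Record action (l : comPzRingType) (B I : nualg l) := Action {
  actl : nuhom B (endalg I);
  actr : nuhom B (opalg (endalg I));
  actlM : forall b x y, (actl b : endo I) (x *n y) = (actl b : endo I) x *n y;
  actrM : forall b x y, (actr b : endo I) (x *n y) = x *n (actr b : endo I) y;
  actM : forall b x y, x *n (actl b : endo I) y = (actr b : endo I) x *n y;
  actlr : forall b c x, (actl b : endo I) ((actr c : endo I) x) =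
                        (actr c : endo I) ((actl b : endo I) x) }.

Definition act_left (l : comPzRingType) (B I : nualg l) (r : action B I) (b : B)
  : endo I := actl r b.
Definition act_right (l : comPzRingType) (B I : nualg l) (r : action B I) (b : B)
  : endo I := actr r b.

Section Semidirect.
Variables (l : comPzRingType) (B I : nualg l) (r : action B I).
Local Notation L := (act_left r).
Local Notation R := (act_right r).

Lemma act_leftM b c x : L (b *n c) x = L b (L c x).
Proof. by rewrite /act_left nuhM. Qed.
Lemma act_rightM b c x : R (b *n c) x = R c (R b x).
Proof. by rewrite /act_right nuhM. Qed.
Lemma act_leftD b c x : L (b + c) x = L b x + L c x.
Proof. by rewrite /act_left linearD. Qed.
Lemma act_rightD b c x : R (b + c) x = R b x + R c x.
Proof. by rewrite /act_right linearD. Qed.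
Lemma act_leftZ a b x : L (a *: b) x = a *: L b x.
Proof. by rewrite /act_left linearZ. Qed.
Lemma act_rightZ a b x : R (a *: b) x = a *: R b x.
Proof. by rewrite /act_right linearZ. Qed.
Lemma act_left0 x : L 0 x = 0.
Proof. by rewrite /act_left linear0. Qed.
Lemma act_right0 x : R 0 x = 0.
Proof. by rewrite /act_right linear0. Qed.

Lemma act_leftDr b x y : L b (x + y) = L b x + L b y.
Proof. exact: linearD. Qed.
Lemma act_rightDr b x y : R b (x + y) = R b x + R b y.
Proof. exact: linearD. Qed.

Definition sd_mul (p q : B * I) : B * I :=
  (p.1 *n q.1, L p.1 q.2 + R q.1 p.2 + p.2 *n q.2).

Definition semidirect : nualg l.
Proof.
apply: (@NUAlg l (B * I)%type sd_mul).
- move=> [b x] [c y] [d z]; rewrite /sd_mul /= nu_mulA; congr pair.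
  rewrite !linearD /= act_leftM act_rightM !nu_mulDr !nu_mulDl.
  rewrite [L b (R d y)](actlr r) [L b (y *n z)](actlM r).
  rewrite [x *n L c z](actM r) [R d (x *n y)](actrM r) nu_mulA.
  rewrite !addrA; congr (_ + _); rewrite -!addrA; congr (_ + (_ + _)).
  by rewrite addrCA; congr (_ + _); rewrite [RHS]addrC -addrA.
- move=> [b x] [c y] [d z]; congr pair => /=; first exact: nu_mulDl.
  rewrite linearD /= act_leftD nu_mulDl.
  by rewrite [RHS]addrACA; congr (_ + _); rewrite addrACA.
- move=> [b x] [c y] [d z]; congr pair => /=; first exact: nu_mulDr.
  rewrite linearD /= act_rightD nu_mulDr.
  by rewrite [RHS]addrACA; congr (_ + _); rewrite addrACA.
- move=> a [b x] [c y]; congr pair => /=; first exact: nu_scaleAl.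
  by rewrite act_leftZ linearZ /= !scalerDr nu_scaleAl.
- move=> a [b x] [c y]; congr pair => /=; first exact: nu_scaleAr.
  by rewrite act_rightZ linearZ /= !scalerDr nu_scaleAr.
Defined.

Lemma sd_mulE b c x y : @nu_mul l semidirect (b, x) (c, y) =
  (b *n c, L b y + R c x + x *n y).
Proof. by []. Qed.

Definition sd_inj : nuhom I semidirect.
Proof.
apply: (@mknuhom l I semidirect (fun x => (0, x))) => [a x y|x y].
  by congr pair; rewrite /= scaler0 addr0.
by rewrite sd_mulE nu_mul0 act_left0 act_right0 !add0r.
Defined.

Definition sd_sec : nuhom B semidirect.
Proof.
apply: (@mknuhom l B semidirect (fun b => (b, 0))) => [a x y|x y].
  by congr pair; rewrite /= scaler0 addr0.
by rewrite sd_mulE nu_mul0 !linear0 !addr0.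
Defined.

Definition sd_proj : nuhom semidirect B.
Proof. exact: (@mknuhom l semidirect B fst). Defined.

Definition sd_extension : extension l.
Proof.
apply: (@Extension l I semidirect B sd_inj sd_proj).
- by move=> x y [].
- by move=> b; exists (b, 0).
- move=> [b x]; split=> [/= ->|[y [<-]]//]; by exists x.
- by exists sd_sec => b.
Defined.

End Semidirect.

Definition sd_map (l : comPzRingType) (B I J : nualg l) (r : action B I)
    (r' : action B J) (f : nuhom I J)
    (fl : forall b x, f (act_left r b x) = act_left r' b (f x))
    (fr : forall b x, f (act_right r b x) = act_right r' b (f x)) :
  nuhom (semidirect r) (semidirect r').
Proof.
apply: (@mknuhom l (semidirect r) (semidirect r') (fun p => (p.1, f p.2))).
  by move=> a p q; congr pair; rewrite linearP.
by move=> [b x] [c y]; congr pair; rewrite /= !linearD /= fl fr nuhM.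
Defined.

(** Its semidirect product is the direct product of algebras. *)
Definition trivial_action (l : comPzRingType) (B I : nualg l) : action B I.
Proof.
apply: (@Action l B I (nuzero _ _) (nuzero _ _)) => //= b x y.
- by rewrite nu_0mul.
- by rewrite nu_mul0.
- by rewrite nu_mul0 nu_0mul.
Defined.

(** * Split exactness *)

Section SplitExact.
Variables (l : comPzRingType) (T : triCat) (X : boundary_theory l T).
Hypothesis X_excisive : excisive X.
Local Notation "g \oc f" :=
  (@mcomp (category_of_additive (tri_add T)) _ _ _ g f) : category_scope.
Local Notation hom x y := (@ahom (tri_add T) x y) (only parsing).
Implicit Types A B D I : nualg l.

Definition hmap A B (f : nuhom A B) : hom (X A) (X B) := @fmap (Alg l) T X A B f.

Lemma hmap_comp A B D (g : nuhom B D) (f : nuhom A B) :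
  hmap (nucomp g f) = hmap g \oc hmap f.
Proof. exact: (@fmapM (Alg l) T X A B D g f). Qed.

Lemma hmap_id A : hmap (nuid A) = @idm T (X A).
Proof. exact: (@fmap1 (Alg l) T X A). Qed.

Lemma sd_dist B I (r : action B I) :
  dist (bt_bd X (sd_extension r)) (hmap (sd_inj r)) (hmap (sd_proj r)).
Proof. exact: (X_excisive.1 (sd_extension r)). Qed.

(** The projection has the multiplicative section [sd_sec], so its image under [X] splits and
    [dist_mono] applies. *)
Lemma hmap_sd_inj_mono B I (r : action B I) y (k k' : hom y (X I)) :
  hmap (sd_inj r) \oc k = hmap (sd_inj r) \oc k' -> k = k'.
Proof.
move=> e; apply/eqP; rewrite -subr_eq0; apply/eqP.
apply: (dist_mono (s := hmap (sd_sec r)) (sd_dist r)).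
  by rewrite -hmap_comp -hmap_id; congr hmap; apply: nuhom_ext.
by rewrite mcompDr mcompNr e subrr.
Qed.

(** The homomorphisms [f] and [nucomp (sd_sec r) g] agree modulo [I], that is, they form a
    quasi-homomorphism; the projection kills the difference of their images under [X]. *)
Lemma hmap_sd_lift B I (r : action B I) A (f : nuhom A (semidirect r))
    (g : nuhom A B) : (forall x, sd_proj r (f x) = g x) ->
  exists q : hom (X A) (X I),
    hmap (sd_inj r) \oc q = hmap f - hmap (nucomp (sd_sec r) g).
Proof.
move=> fg; apply: (dist_lift (sd_dist r)).
rewrite mcompDr mcompNr -!hmap_comp.
rewrite (_ : nucomp _ f = nucomp (sd_proj r) (nucomp (sd_sec r) g)) ?subrr //.
exact: nuhom_ext.
Qed.

(** The zero homomorphism is the inclusion of one factor of a direct product followed by the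
    projection to the other, two consecutive arrows of a triangle. *)
Lemma hmap_zero A B : hmap (nuzero A B) = 0.
Proof.
rewrite -(dist_comp0 (sd_dist (trivial_action B A))) -hmap_comp.
by congr hmap; apply: nuhom_ext.
Qed.

(* [s] factors through the diagonal of [A * A], whose two projections split
   [X (A * A)] as a biproduct. *)
Lemma hmap_orthogonal_sum A D (g h s : nuhom A D) :
  (forall x, s x = g x + h x) ->
  (forall x y, g x *n h y = 0) -> (forall x y, h x *n g y = 0) ->
  hmap s = hmap g + hmap h.
Proof.
move=> sE gh hg; pose t := trivial_action A A; pose P := semidirect t.
have pl : linear (fun p : P => p.2) by [].
have pM (p p' : P) : (p *n p').2 = p.2 *n p'.2 by rewrite /= !add0r.
pose pr2 : nuhom P A := mknuhom pl pM.
have dl : linear (fun x : A => (x, x) : P) by [].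
have dM (x x' : A) : ((x *n x', x *n x') : P) = ((x, x) : P) *n ((x', x') : P).
  by congr pair; rewrite /= !add0r.
pose diag : nuhom A P := mknuhom dl dM.
have ml : linear (fun p : P => g p.1 + h p.2).
  by move=> a [x y] [x' y'] /=; rewrite !linearP scalerDr addrACA.
have mM (p p' : P) : g (p *n p').1 + h (p *n p').2 =
    (g p.1 + h p.2) *n (g p'.1 + h p'.2).
  by rewrite /= !add0r !nuhM nu_mulDl !nu_mulDr gh hg addr0 add0r.
pose m : nuhom P D := mknuhom ml mM.
(* The identity of [P] minus the idempotent onto the first factor lifts to [q], and composing with
   [pr2] identifies [q]. *)
have [|q qE] := @hmap_sd_lift A A t P (nuid P) (sd_proj t); first by [].
have q2 : q = hmap pr2.
  have := congr1 (fun k => hmap pr2 \oc k) qE.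
  rewrite mcompDr mcompNr mcompA -!hmap_comp nucompA.
  rewrite (_ : nucomp pr2 (sd_inj t) = nuid A); last exact: nuhom_ext.
  rewrite (_ : nucomp pr2 (sd_sec t) = nuzero A A); last exact: nuhom_ext.
  rewrite nucompm1 hmap_comp hmap_zero mcomp0l subr0 hmap_id => <-.
  by rewrite [RHS]mcomp1m.
have <- : nucomp m diag = s by apply: nuhom_ext => x; rewrite sE.
(* Between [m] and [diag], the equation for [q] becomes [hmap h = hmap s - hmap g]. *)
have := congr1 (fun k => hmap m \oc (k \oc hmap diag)) qE.
rewrite mcompDl mcompNl mcompDr mcompNr q2 -!hmap_comp.
rewrite (_ : nucomp m (nucomp (nucomp (sd_inj t) pr2) diag) = h); last first.
  by apply: nuhom_ext => x /=; rewrite linear0 add0r.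
rewrite (_ : nucomp m (nucomp (nucomp (sd_sec t) _) diag) = g); last first.
  by apply: nuhom_ext => x /=; rewrite linear0 addr0.
by rewrite nucomp1m => ->; rewrite addrC subrK.
Qed.

End SplitExact.

(** * Polynomials and matrices *)

Section FiniteSupportInduction.
Variables (l : comPzRingType) (S : choiceType) (V : lmodType l).

Lemma fs_sum (I : Type) (r : seq I) (F : I -> fsmod S V) s :
  (\sum_(i <- r) F i) s = \sum_(i <- r) F i s.
Proof. by elim/big_rec2: _ => // i x f _ <-. Qed.

Lemma fs_ind (P : fsmod S V -> Prop) : P 0 ->
  (forall s v, P (fs_single s v)) -> (forall f g, P f -> P g -> P (f + g)) ->
  forall f, P f.
Proof.
move=> P0 P1 PD f; have [r ur fr] := fs_seq f.
rewrite (_ : f = \sum_(s <- r) fs_single s (f s)).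
  by elim/big_rec: _ => // s g _; apply: PD.
apply: fsP => t; rewrite fs_sum.
have [tr|tr] := boolP (t \in r).
  rewrite (bigD1_seq t) //= eqxx big1 ?addr0 // => s st.
  by rewrite eq_sym (negPf st).
rewrite big_seq big1 => [|s sr].
  by apply/eqP; apply: contraNT tr => /fr.
by rewrite fs_singleE; case: eqP => // ts; rewrite ts sr in tr.
Qed.

Lemma fs_single_eq0 (s : S) : fs_single s (0 : V) = 0.
Proof. exact: linear0. Qed.

Lemma fs_singleD (s : S) (u v : V) : fs_single s (u + v) = fs_single s u + fs_single s v.
Proof. exact: linearD. Qed.

End FiniteSupportInduction.

Section PolynomialEvaluation.
Variables (l : comPzRingType) (A : nualg l).

Lemma poly_singleM m n (x y : A) :
  @nu_mul l (polyalg A) (fs_single m x) (fs_single n y) = fs_single (m + n)%N (x *n y).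
Proof.
apply: fsP => k; rewrite [LHS]polyalg_mulE fs_singleE.
have [mk|mk] := leqP m k; last first.
  rewrite big1 => [|i _].
    by case: eqP => // e; rewrite e ltnNge leq_addr in mk.
  rewrite fs_singleE; case: eqP => [e|_]; last by rewrite nu_0mul.
  by have := ltn_ord i; rewrite e ltnS leqNgt mk.
rewrite (bigD1 (Ordinal (mk : (m < k.+1)%N))) //= big1 ?addr0 => [|i im].
  rewrite eqxx -(eqn_add2l m (k - m)) subnKC //.
  by case: ifP => // _; rewrite nu_mul0.
case: eqP => [e|_]; last by rewrite nu_0mul.
by case/eqP: im; apply: val_inj.
Qed.

Definition ev0 : nuhom (polyalg A) A.
Proof.
apply: (@mknuhom l (polyalg A) A (fun p => p 0%N)) => // p q.
by rewrite [LHS]polyalg_mulE big_ord1.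
Defined.

(** Evaluation at [t = 1], the index being the exponent of [t]. *)
Definition ev1_fun (p : polyalg A) : A := \sum_(n \in [set: nat]) (p : fsmod nat A) n.

Lemma ev1_linear : linear ev1_fun.
Proof.
move=> a p q; have [r _ pr] := fs_seq p; have [s _ qs] := fs_seq q.
rewrite /ev1_fun !(@fsum_seq _ _ (undup (r ++ s))) ?undup_uniq //.
- by rewrite scaler_sumr -big_split.
- by move=> n /qs ns; rewrite mem_undup mem_cat ns orbT.
- by move=> n /pr nr; rewrite mem_undup mem_cat nr.
move=> n hn; rewrite mem_undup mem_cat; have [p0|/pr->//] := eqVneq ((p : fsmod _ _) n) 0.
rewrite qs ?orbT //; apply: contraNneq hn => q0.
by rewrite fs_add fs_scale p0 q0 scaler0 addr0.
Qed.

Lemma ev1_single n x : ev1_fun (fs_single n x) = x.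
Proof.
rewrite /ev1_fun (@fsum_seq _ _ [:: n]) // => [|k].
  by rewrite big_seq1 fs_singleE eqxx.
by rewrite fs_singleE inE; case: (k =P n) => // _ /negP[].
Qed.

HB.instance Definition _ := GRing.isLinear.Build _ _ _ _ ev1_fun ev1_linear.

Lemma ev1M (p q : polyalg A) : ev1_fun (p *n q) = ev1_fun p *n ev1_fun q.
Proof.
elim/fs_ind: p => [|m x|p p' hp hp']; first by rewrite nu_0mul linear0 nu_0mul.
  elim/fs_ind: q => [|n y|q q' hq hq']; first by rewrite nu_mul0 linear0 nu_mul0.
    by rewrite poly_singleM !ev1_single.
  by rewrite nu_mulDr !linearD /= hq hq' nu_mulDr.
by rewrite nu_mulDl !linearD /= hp hp' nu_mulDl.
Qed.

Definition ev1 : nuhom (polyalg A) A := @NUHom l _ _ (ev1_fun : {linear _ -> _}) ev1M.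

(* The segment (1 - t) x + t y. *)
Definition segment (x y : A) : polyalg A := fs_single 0%N x + fs_single 1%N (y - x).

Lemma ev0_segment x y : ev0 (segment x y) = x.
Proof. exact: (addr0 x). Qed.

Lemma ev1_segment x y : ev1 (segment x y) = y.
Proof. by rewrite linearD /= !ev1_single addrC subrK. Qed.

Lemma segmentxx x : segment x x = polyalg_const A x.
Proof. by rewrite /segment subrr fs_single_eq0 addr0. Qed.

Lemma segmentD x y x' y' : segment x y + segment x' y' = segment (x + x') (y + y').
Proof. by rewrite /segment addrACA -!fs_singleD opprD [y + _ + _]addrACA. Qed.

(** A constant factor keeps a path affine, whereas a product of two segments has degree two in
    general. A linear homotopy can therefore move only one factor of each product. *)
Lemma segmentMl x y z : polyalg_const A x *n segment y z = segment (x *n y) (x *n z).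
Proof.
have e : x *n z - x *n y = x *n (z - y).
  by apply: (addIr (x *n y)); rewrite -nu_mulDr !subrK.
by rewrite nu_mulDr !poly_singleM /segment e.
Qed.

Lemma segmentMr x y z : segment y z *n polyalg_const A x = segment (y *n x) (z *n x).
Proof.
have e : z *n x - y *n x = (z - y) *n x.
  by apply: (addIr (y *n x)); rewrite -nu_mulDl !subrK.
by rewrite nu_mulDl !poly_singleM /segment e.
Qed.

End PolynomialEvaluation.

Section MatrixFunctor.
Variables (l : comPzRingType) (S : choiceType).
Implicit Types A B : nualg l.

Definition mat_single A (s t : S) (x : A) : matalg S A := fs_single (s, t) x.
Arguments mat_single : simpl never.

Lemma mat_singleE A s t (x : A) i j :
  (mat_single s t x : fsmod _ _) (i, j) = if (i == s) && (j == t) then x else 0.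
Proof. by rewrite /mat_single fs_singleE xpair_eqE. Qed.

Lemma mat_single_linear A s t : linear (@mat_single A s t).
Proof. by move=> a x y; rewrite /mat_single [LHS]linearP. Qed.

HB.instance Definition _ A s t :=
  GRing.isLinear.Build _ _ _ _ (@mat_single A s t) (@mat_single_linear A s t).

Lemma mat_single0 A s t : mat_single s t (0 : A) = 0.
Proof. exact: linear0. Qed.

Lemma mat_singleD A s t (x y : A) :
  mat_single s t (x + y) = mat_single s t x + mat_single s t y.
Proof. exact: linearD. Qed.

Lemma mat_ind A (P : matalg S A -> Prop) : P 0 ->
  (forall s t x, P (mat_single s t x)) ->
  (forall M N, P M -> P N -> P (M + N)) -> forall M, P M.
Proof. by move=> P0 P1 PD M; apply: (@fs_ind l _ A) => // -[s t] x; exact: P1. Qed.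

Lemma mat_singleM A (s t u v : S) (x y : A) :
  mat_single s t x *n mat_single u v y =
  if t == u then mat_single s v (x *n y) else 0.
Proof.
apply: fsP => -[i j]; rewrite [LHS]matalg_mulE (@fsum_seq _ _ [:: t]) // => [|k].
  rewrite big_seq1 !mat_singleE eqxx andbT.
  case: (t =P u) => [_|_]; last by rewrite /= nu_mul0.
  by rewrite mat_singleE; case: (i == s); case: (j == v); rewrite /= ?nu_mul0 ?nu_0mul.
rewrite !mat_singleE inE.
by case: (k =P t) => // _; rewrite andbF nu_0mul eqxx.
Qed.

Lemma matmap_finite A B (f : nuhom A B) (M : matalg S A) :
  finite_set [set p | f ((M : fsmod _ A) p) != 0].
Proof.
apply: sub_finite_set (fs_finite (M : fsmod _ A)) => p /=.
by apply: contraNneq => ->; rewrite linear0.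
Qed.

Definition matmap_fun A B (f : nuhom A B) (M : matalg S A) : matalg S B :=
  mkfs (matmap_finite f M).

Lemma matmap_linear A B (f : nuhom A B) : linear (matmap_fun f).
Proof. by move=> a M N; apply: fsP => p /=; rewrite linearP. Qed.

Lemma matmap_single A B (f : nuhom A B) s t x :
  matmap_fun f (mat_single s t x) = mat_single s t (f x).
Proof. by apply: fsP => q /=; rewrite [LHS]fun_if linear0. Qed.

HB.instance Definition _ A B (f : nuhom A B) :=
  GRing.isLinear.Build _ _ _ _ (matmap_fun f) (matmap_linear f).

Lemma matmap_funD A B (f : nuhom A B) M N :
  matmap_fun f (M + N) = matmap_fun f M + matmap_fun f N.
Proof. exact: linearD. Qed.

Lemma matmap_fun0 A B (f : nuhom A B) : matmap_fun f 0 = 0.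
Proof. exact: linear0. Qed.

Lemma matmapM A B (f : nuhom A B) (M N : matalg S A) :
  matmap_fun f (M *n N) = matmap_fun f M *n matmap_fun f N.
Proof.
elim/mat_ind: M => [|s t x|M M' hM hM']; first by rewrite nu_0mul matmap_fun0 nu_0mul.
  elim/mat_ind: N => [|u v y|N N' hN hN']; first by rewrite nu_mul0 matmap_fun0 nu_mul0.
    rewrite mat_singleM !matmap_single mat_singleM.
    by case: ifP => _; rewrite ?matmap_fun0 ?matmap_single ?nuhM.
  by rewrite nu_mulDr !matmap_funD hN hN' nu_mulDr.
by rewrite nu_mulDl !matmap_funD hM hM' nu_mulDl.
Qed.

Definition matmap A B (f : nuhom A B) : nuhom (matalg S A) (matalg S B) :=
  @NUHom l _ _ (matmap_fun f : {linear _ -> _}) (matmapM f).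

Lemma matmap_corner A B (f : nuhom A B) (s : S) :
  nucomp (matmap f) (mat_corner A s) = nucomp (mat_corner B s) f.
Proof. by apply: nuhom_ext => x; exact: matmap_single. Qed.

End MatrixFunctor.

(** * Presented algebras and partial permutation matrices *)

Section PresentedAlgebra.
Variables (l : comPzRingType) (X : Type) (R : aterm l X -> aterm l X -> Prop).

(** Every element is the value of a term in the generators; opposites are covered by the scalar
    [-1]. *)
Lemma pres_gen_ind (P : presalg R -> Prop) :
  (forall x, P (pres_gen R x)) -> P 0 -> (forall a x, P x -> P (a *: x)) ->
  (forall x y, P x -> P y -> P (x + y)) ->
  (forall x y, P x -> P y -> P (x *n y)) -> forall x, P x.
Proof.
move=> Pg P0 PZ PD PM; elim/pres_ind=> t; rewrite -aeval_pres_gen.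
elim: t => [x||t|t Pt u Pu|a t|t Pt u Pu].
- exact: Pg.
- exact: P0.
- by move=> /(PZ (-1)); rewrite scaleN1r.
- exact: PD.
- exact: PZ.
- exact: PM.
Qed.

Lemma pres_hom_ext (B : nualg l) (f g : nuhom (presalg R) B) :
  (forall x, f (pres_gen R x) = g (pres_gen R x)) -> f = g.
Proof.
move=> fg; apply: nuhom_ext; elim/pres_gen_ind => [//||a x|x y|x y].
- by rewrite !linear0.
- by rewrite !linearZ /= => ->.
- by rewrite !linearD /= => -> ->.
- by rewrite !nuhM => -> ->.
Qed.

Definition pres_map (B : nualg l) (f : X -> B)
    (fR : forall t u, R t u -> aeval f t = aeval f u) : nuhom (presalg R) B :=
  sval (cid (pres_lift fR)).

Lemma pres_map_gen (B : nualg l) (f : X -> B)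
    (fR : forall t u, R t u -> aeval f t = aeval f u) x :
  pres_map fR (pres_gen R x) = f x.
Proof. by rewrite /pres_map; case: cid => g [gE _] /=. Qed.

End PresentedAlgebra.

(** A partial bijection encodes a matrix of zeros and ones with at most one 1 in each row and
    column. Its support may be infinite, so it acts on [matalg] as a multiplier and need not belong
    to it. *)
Record pbij (S : Type) := PBij {
  pfun : S -> option S;
  pinv : S -> option S;
  pbijP : forall s u, pfun s = Some u <-> pinv u = Some s }.

Definition pbij_inv S (b : pbij S) : pbij S :=
  @PBij S (pinv b) (pfun b) (fun s u => iff_sym (pbijP b u s)).

Section PartialPermutation.
Variables (l : comPzRingType) (S : choiceType) (A : nualg l).
Implicit Types (b c : pbij S) (M N : matalg S A).

Lemma row_finite b M : finite_set
  [set p : S * S | oapp (fun u => (M : fsmod _ _) (u, p.2)) 0 (pfun b p.1) != 0].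
Proof.
(* The support of the product comes from that of [M] by moving rows along [pinv b]; the default in
   [odflt] only makes this map total. *)
apply: sub_finite_set (finite_image
  (fun p : S * S => (odflt p.1 (pinv b p.1), p.2)) (fs_finite M)) => -[s t] /=.
case e: (pfun b s) => [u|] /= h; last by rewrite eqxx in h.
by exists (u, t) => //=; move/(pbijP b): e => ->.
Qed.

Lemma col_finite b M : finite_set
  [set p : S * S | oapp (fun u => (M : fsmod _ _) (p.1, u)) 0 (pfun b p.2) != 0].
Proof.
apply: sub_finite_set (finite_image
  (fun p : S * S => (p.1, odflt p.2 (pinv b p.2))) (fs_finite M)) => -[s t] /=.
case e: (pfun b t) => [u|] /= h; last by rewrite eqxx in h.
by exists (s, u) => //=; move/(pbijP b): e => ->.
Qed.

Lemma row_linear b : linear (fun M => mkfs (row_finite b M) : matalg S A).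
Proof.
move=> a M N; apply: fsP => -[s t]; rewrite fs_add fs_scale /=.
by case: pfun => //=; rewrite scaler0 addr0.
Qed.

Lemma col_linear b : linear (fun M => mkfs (col_finite b M) : matalg S A).
Proof.
move=> a M N; apply: fsP => -[s t]; rewrite fs_add fs_scale /=.
by case: pfun => //=; rewrite scaler0 addr0.
Qed.

(* Writing [b] also for the matrix with entry 1 at [(s, u)] whenever
   [pfun b s = Some u], these are [M |-> b M] and [M |-> M b]. *)
Definition row_op b : endo (matalg S A) := mkendo (row_linear b).
Definition col_op b : endo (matalg S A) := mkendo (col_linear (pbij_inv b)).

Lemma row_opE b M s t : (row_op b M : fsmod _ _) (s, t) =
  oapp (fun u => (M : fsmod _ _) (u, t)) 0 (pfun b s).
Proof. by []. Qed.

Lemma col_opE b M s t : (col_op b M : fsmod _ _) (s, t) =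
  oapp (fun u => (M : fsmod _ _) (s, u)) 0 (pinv b t).
Proof. by []. Qed.

Lemma row_op_single b s t x :
  row_op b (mat_single s t x) = oapp (fun u => mat_single u t x) 0 (pinv b s).
Proof.
apply: fsP => -[i j]; rewrite row_opE.
case ei: (pfun b i) => [u|]; case es: (pinv b s) => [w|] //=.
- rewrite !xpair_eqE; case: (j == t); rewrite ?andbF // !andbT.
  congr (if _ then _ else _); apply/eqP/eqP => [e|e].
    by move: es ei => /(pbijP b); rewrite e => es /(pbijP b); move/(pbijP b): es => -> [->].
  by move: es => /(pbijP b); rewrite -e ei => -[].
- rewrite xpair_eqE; case: (u =P s) => //= e.
  by move/(pbijP b): ei; rewrite e es.
- rewrite xpair_eqE; case: (i =P w) => //= e.
  by move/(pbijP b): es; rewrite -e ei.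
Qed.

Lemma col_op_single b s t x :
  col_op b (mat_single s t x) = oapp (fun u => mat_single s u x) 0 (pfun b t).
Proof.
apply: fsP => -[i j]; rewrite col_opE.
case ej: (pinv b j) => [u|]; case et: (pfun b t) => [w|] //=.
- rewrite !xpair_eqE; case: (i == s); rewrite ?andbF //=.
  congr (if _ then _ else _); apply/eqP/eqP => [e|e].
    by move: ej => /(pbijP b); rewrite e et => -[].
  by move: et => /(pbijP b); rewrite -e ej => -[].
- rewrite xpair_eqE; case: (u =P t) => [e|]; rewrite ?andbF //.
  by move/(pbijP b): ej; rewrite e et.
- rewrite xpair_eqE; case: (j =P w) => [e|]; rewrite ?andbF //.
  by move/(pbijP b): et; rewrite -e ej.
Qed.

Lemma row_opM b M N : row_op b (M *n N) = row_op b M *n N.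
Proof.
apply: fsP => -[s t]; rewrite row_opE [RHS]matalg_mulE.
under eq_fsbigr => u _ do rewrite row_opE.
case: pfun => [w|] //=; rewrite (@fsum_seq _ _ [::]) ?big_nil // => u.
by rewrite nu_0mul eqxx.
Qed.

Lemma col_opM b M N : col_op b (M *n N) = M *n col_op b N.
Proof.
apply: fsP => -[s t]; rewrite col_opE [RHS]matalg_mulE.
under eq_fsbigr => u _ do rewrite col_opE.
case: pinv => [w|] //=; rewrite (@fsum_seq _ _ [::]) ?big_nil // => u.
by rewrite nu_mul0 eqxx.
Qed.

Lemma row_col_op b c M : row_op b (col_op c M) = col_op c (row_op b M).
Proof.
apply: fsP => -[s t]; rewrite row_opE col_opE.
by case e: (pfun b s) => [u|] /=; case f: (pinv c t) => [w|] //=; rewrite ?e ?f.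
Qed.

(** Associativity with the possibly infinite matrix [b] in the middle; by bilinearity it is enough
    to compare matrix units. *)
Lemma mul_row_op b M N : M *n row_op b N = col_op b M *n N.
Proof.
elim/mat_ind: M => [|s t x|M M' hM hM'].
- by rewrite nu_0mul linear0 nu_0mul.
- elim/mat_ind: N => [|u v y|N N' hN hN'].
  + by rewrite nu_mul0 linear0 nu_mul0.
  + rewrite row_op_single col_op_single.
    case et: (pfun b t) => [w|]; case eu: (pinv b u) => [w'|];
      rewrite ![oapp _ _ _]/= ?nu_mul0 ?nu_0mul ?mat_singleM //.
    * congr (if _ then _ else _); apply/eqP/eqP => [e|e].
        by move/(pbijP b): eu; rewrite -e et => -[].
      by move/(pbijP b): et; rewrite e eu => -[].
    * case: (w =P u) => // e; by move/(pbijP b): et; rewrite e eu.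
    * case: (t =P w') => // e; by move/(pbijP b): eu; rewrite -e et.
  + by rewrite linearD [LHS]nu_mulDr [RHS]nu_mulDr -hN -hN'.
by rewrite nu_mulDl linearD [RHS]nu_mulDl -hM -hM'.
Qed.

End PartialPermutation.

(** * The truncated Fock representation *)

Section PathShift.
Variable E : digraph.
Implicit Types (x y : cohn_gen E) (p q : seq (edge E)).

Definition gen_star x : cohn_gen E :=
  match x with CVert v => CVert v | CEdge e => CGhost e | CGhost e => CEdge e end.

Lemma gen_starK : involutive gen_star.
Proof. by case. Qed.

Definition starts (v : vert E) p := if p is f :: _ then src f == v else false.

(* [x] sends the basis element [q] to [p]
   when [path_shift x p = Some q], and every generator kills [[::]].  The lists
   are not required to be composable beyond their first edge. *)
Definition path_shift x p : option (seq (edge E)) :=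
  match x with
  | CVert v => if starts v p then Some p else None
  | CEdge e => if p is f :: q then
                 if (f == e) && starts (rng e) q then Some q else None
               else None
  | CGhost e => if starts (rng e) p then Some (e :: p) else None
  end.

Lemma path_shift_star x p q :
  path_shift x p = Some q -> path_shift (gen_star x) q = Some p.
Proof.
case: x => [v|e|e] /=.
- by case: ifP => // pv [<-]; rewrite pv.
- by case: p => // f p; case: ifP => // /andP[/eqP-> ep] [<-]; rewrite ep.
- by case: ifP => // ep [<-]; rewrite eqxx ep.
Qed.

Definition opt_term (l : Type) (z : option (cohn_gen E)) : aterm l (cohn_gen E) :=
  if z is Some z then AGen z else AZero.

(** All the relations say that a product of two generators is a generator or zero, so they can be
    checked uniformly. The first identity of shifts serves the action on rows, the starred one in
    reversed order the action on columns. *)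
Lemma cohn_relP (l : comPzRingType) t u : @cohn_rel l E t u -> exists x y z,
  [/\ t = AMul (AGen x) (AGen y), u = opt_term l z,
      forall p, obind (path_shift y) (path_shift x p) =
                obind (fun z => path_shift z p) z &
      forall p, obind (path_shift (gen_star x)) (path_shift (gen_star y) p) =
                obind (fun z => path_shift (gen_star z) p) z].
Proof.
case=> [v|v w vw|e|e|e|e|e|e f ef].
- exists (CVert v), (CVert v), (Some (CVert v)); split=> // p /=;
    by case: ifP => //= ->.
- exists (CVert v), (CVert w), None; split=> // -[|f p] //=;
    by case: eqP => //= -> ; case: eqP => // wv; case: vw; rewrite wv.
- exists (CVert (src e)), (CEdge e), (Some (CEdge e)); split=> // -[|f p] //=.
    case: (f =P e) => [->|fe] /=; first by rewrite eqxx /= eqxx.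
    by case: eqP => //= _; case: eqP.
  by case: eqP => //= _; rewrite eqxx.
- exists (CEdge e), (CVert (rng e)), (Some (CEdge e)); split=> // -[|f p] //=.
    by case: ifP => //= /andP[_ ->].
  by case: ifP => //= ->.
- exists (CVert (rng e)), (CGhost e), (Some (CGhost e)); split=> // -[|f p] //=.
    by case: ifP => //= ->.
  by case: ifP => //= /andP[_ ->].
- exists (CGhost e), (CVert (src e)), (Some (CGhost e)); split=> // -[|f p] //=.
    by case: ifP => //= _; rewrite eqxx.
  case: (f =P e) => [->|fe] /=; first by rewrite eqxx /= eqxx.
  by case: eqP => //= _; case: eqP.
- exists (CGhost e), (CEdge e), (Some (CVert (rng e))); split=> // -[|f p] //=;
    by case: ifP => //= ->; rewrite eqxx.
- exists (CGhost e), (CEdge f), None; split=> // -[|g p] //=;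
    by case: ifP => //= _; case: eqP => // fe; case: ef; rewrite fe.
Qed.

End PathShift.

Section CohnAction.
Variables (l : comPzRingType) (E : digraph) (S : choiceType).
Variables (iota : seq (edge E) -> S) (iota_inj : injective iota).
Implicit Types (x y : cohn_gen E) (p q : seq (edge E)) (A : nualg l).

Definition iota_inv (s : S) : option (seq (edge E)) :=
  if pselect (exists p, iota p = s) is left h then Some (sval (cid h)) else None.

Lemma iotaK : pcancel iota iota_inv.
Proof.
move=> p; rewrite /iota_inv; case: pselect => [h|[]]; last by exists p.
by case: cid => q /= /iota_inj ->.
Qed.

Lemma iota_invP s p : iota_inv s = Some p -> s = iota p.
Proof.
by rewrite /iota_inv; case: pselect => // h [<-]; case: cid => q /= ->.
Qed.

(** The representation is carried to [S] along [iota] and is zero off the range of [iota]. *)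
Definition shift_fun x (s : S) : option S :=
  omap iota (obind (path_shift x) (iota_inv s)).

Lemma shift_fun_iota x p : shift_fun x (iota p) = omap iota (path_shift x p).
Proof. by rewrite /shift_fun iotaK. Qed.

Lemma shift_fun_star x s u : shift_fun x s = Some u -> shift_fun (gen_star x) u = Some s.
Proof.
rewrite {1}/shift_fun; case es: (iota_inv s) => [p|] //=.
case e: (path_shift x p) => [q|] //= -[<-].
by rewrite shift_fun_iota (path_shift_star e) (iota_invP es).
Qed.

Definition shift x : pbij S.
Proof.
apply: (@PBij S (shift_fun x) (shift_fun (gen_star x))) => s u.
split; first exact: shift_fun_star.
by move/shift_fun_star; rewrite gen_starK.
Defined.

Lemma cohn_rel_shift t u : @cohn_rel l E t u -> exists x y z,
  [/\ t = AMul (AGen x) (AGen y), u = opt_term l z,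
      forall s, obind (shift_fun y) (shift_fun x s) =
                obind (fun z => shift_fun z s) z &
      forall s, obind (shift_fun (gen_star x)) (shift_fun (gen_star y) s) =
                obind (fun z => shift_fun (gen_star z) s) z].
Proof.
move=> /cohn_relP[x [y [z [-> -> h1 h2]]]]; exists x, y, z.
have comp x1 y1 s : obind (shift_fun y1) (shift_fun x1 s) =
    omap iota (obind (fun p => obind (path_shift y1) (path_shift x1 p)) (iota_inv s)).
  rewrite {2}/shift_fun; case: iota_inv => //= p.
  by case: path_shift => //= q; rewrite shift_fun_iota.
split=> // s; rewrite comp /shift_fun; case: iota_inv => [p|] /=.
- by rewrite h1; case: z {h1 h2}.
- by case: z {h1 h2}.
- by rewrite h2; case: z {h1 h2}.
- by case: z {h1 h2}.
Qed.

Lemma row_shift_rel A t u : @cohn_rel l E t u ->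
  aeval (fun x => row_op A (shift x) : endalg (matalg S A)) t =
  aeval (fun x => row_op A (shift x) : endalg (matalg S A)) u.
Proof.
move=> /cohn_rel_shift[x [y [z [-> -> h _]]]]; apply: endoP => M.
apply: fsP => -[s i].
transitivity (oapp (fun w => (M : fsmod _ _) (w, i)) 0
    (obind (shift_fun y) (shift_fun x s))).
  by rewrite [aeval _ _]/= /=; case: shift_fun.
by rewrite h; case: z {h}.
Qed.

Lemma col_shift_rel A t u : @cohn_rel l E t u ->
  aeval (fun x => col_op A (shift x) : opalg (endalg (matalg S A))) t =
  aeval (fun x => col_op A (shift x) : opalg (endalg (matalg S A))) u.
Proof.
move=> /cohn_rel_shift[x [y [z [-> -> _ h]]]]; apply: endoP => M.
apply: fsP => -[s i].
transitivity (oapp (fun w => (M : fsmod _ _) (s, w)) 0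
    (obind (shift_fun (gen_star x)) (shift_fun (gen_star y) i))).
  by rewrite [aeval _ _]/= /=; case: shift_fun.
by rewrite h; case: z {h}.
Qed.

Local Notation C := (cohn l E).
Local Notation gen x := (pres_gen (@cohn_rel l E) x).

Definition cohn_row A : nuhom C (endalg (matalg S A)) := pres_map (row_shift_rel A).
Definition cohn_col A : nuhom C (opalg (endalg (matalg S A))) :=
  pres_map (col_shift_rel A).

Definition lact A (b : C) : endo (matalg S A) := cohn_row A b.
Definition ract A (b : C) : endo (matalg S A) := cohn_col A b.

Lemma lact_gen A x M : lact A (gen x) M = row_op A (shift x) M.
Proof. by rewrite /lact (pres_map_gen (row_shift_rel A)). Qed.
Lemma ract_gen A x M : ract A (gen x) M = col_op A (shift x) M.
Proof. by rewrite /ract (pres_map_gen (col_shift_rel A)). Qed.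
Lemma lact0 A M : lact A 0 M = 0. Proof. by rewrite /lact linear0. Qed.
Lemma ract0 A M : ract A 0 M = 0. Proof. by rewrite /ract linear0. Qed.
Lemma lactZ A a b M : lact A (a *: b) M = a *: lact A b M.
Proof. by rewrite /lact linearZ. Qed.
Lemma ractZ A a b M : ract A (a *: b) M = a *: ract A b M.
Proof. by rewrite /ract linearZ. Qed.
Lemma lactD A b c M : lact A (b + c) M = lact A b M + lact A c M.
Proof. by rewrite /lact linearD. Qed.
Lemma ractD A b c M : ract A (b + c) M = ract A b M + ract A c M.
Proof. by rewrite /ract linearD. Qed.
Lemma lactM A b c M : lact A (b *n c) M = lact A b (lact A c M).
Proof. by rewrite /lact nuhM. Qed.
Lemma ractM A b c M : ract A (b *n c) M = ract A c (ract A b M).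
Proof. by rewrite /ract nuhM. Qed.

Lemma lact_mul A b (M N : matalg S A) : lact A b (M *n N) = lact A b M *n N.
Proof.
elim/pres_gen_ind: b M N => [x||a b hb|b c hb hc|b c hb hc] M N.
- by rewrite !lact_gen row_opM.
- by rewrite !lact0 nu_0mul.
- by rewrite !lactZ hb nu_scaleAl.
- by rewrite !lactD hb hc nu_mulDl.
- by rewrite !lactM hc hb.
Qed.

Lemma ract_mul A b (M N : matalg S A) : ract A b (M *n N) = M *n ract A b N.
Proof.
elim/pres_gen_ind: b M N => [x||a b hb|b c hb hc|b c hb hc] M N.
- by rewrite !ract_gen col_opM.
- by rewrite !ract0 nu_mul0.
- by rewrite !ractZ hb nu_scaleAr.
- by rewrite !ractD hb hc nu_mulDr.
- by rewrite !ractM hb hc.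
Qed.

Lemma mul_lact A b (M N : matalg S A) : M *n lact A b N = ract A b M *n N.
Proof.
elim/pres_gen_ind: b M N => [x||a b hb|b c hb hc|b c hb hc] M N.
- by rewrite lact_gen ract_gen mul_row_op.
- by rewrite lact0 ract0 nu_0mul nu_mul0.
- by rewrite lactZ ractZ -nu_scaleAr hb nu_scaleAl.
- by rewrite lactD ractD nu_mulDr hb hc nu_mulDl.
- by rewrite lactM ractM hb hc.
Qed.

Lemma lact_ract A b c (M : matalg S A) :
  lact A b (ract A c M) = ract A c (lact A b M).
Proof.
elim/pres_gen_ind: b c M => [x||a b hb|b b' hb hb'|b b' hb hb'] c M.
- elim/pres_gen_ind: c M => [y||a c hc|c c' hc hc'|c c' hc hc'] M.
  + by rewrite !ract_gen !lact_gen row_col_op.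
  + by rewrite !ract0 linear0.
  + by rewrite !ractZ linearZ /= hc.
  + by rewrite !ractD linearD /= hc hc'.
  + by rewrite !ractM hc' hc.
- by rewrite !lact0 linear0.
- by rewrite !lactZ linearZ /= hb.
- by rewrite !lactD linearD /= hb hb'.
- by rewrite !lactM hb' hb.
Qed.

Definition cohn_action A : action C (matalg S A) :=
  @Action l C (matalg S A) (cohn_row A) (cohn_col A)
    (@lact_mul A) (@ract_mul A) (@mul_lact A) (@lact_ract A).

Lemma cohn_act_leftE A x M : act_left (cohn_action A) (gen x) M = row_op A (shift x) M.
Proof. exact: lact_gen. Qed.

Lemma cohn_act_rightE A x M : act_right (cohn_action A) (gen x) M = col_op A (shift x) M.
Proof. exact: ract_gen. Qed.

Lemma matmap_row_op A A' (f : nuhom A A') b (M : matalg S A) :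
  matmap S f (row_op A b M) = row_op A' b (matmap S f M).
Proof. by apply: fsP => -[s t] /=; case: pfun => //=; rewrite linear0. Qed.

Lemma matmap_col_op A A' (f : nuhom A A') b (M : matalg S A) :
  matmap S f (col_op A b M) = col_op A' b (matmap S f M).
Proof. by apply: fsP => -[s t] /=; case: pinv => //=; rewrite linear0. Qed.

Lemma matmap_act_left A A' (f : nuhom A A') b M :
  matmap S f (act_left (cohn_action A) b M) =
  act_left (cohn_action A') b (matmap S f M).
Proof.
elim/pres_gen_ind: b M => [x||a b hb|b c hb hc|b c hb hc] M.
- by rewrite !cohn_act_leftE matmap_row_op.
- by rewrite !act_left0 linear0.
- by rewrite !act_leftZ linearZ hb.
- by rewrite !act_leftD linearD hb hc.
- by rewrite !act_leftM hb hc.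
Qed.

Lemma matmap_act_right A A' (f : nuhom A A') b M :
  matmap S f (act_right (cohn_action A) b M) =
  act_right (cohn_action A') b (matmap S f M).
Proof.
elim/pres_gen_ind: b M => [x||a b hb|b c hb hc|b c hb hc] M.
- by rewrite !cohn_act_rightE matmap_col_op.
- by rewrite !act_right0 linear0.
- by rewrite !act_rightZ linearZ hb.
- by rewrite !act_rightD linearD hb hc.
- by rewrite !act_rightM hc hb.
Qed.

Definition cohn_sd_map A A' (f : nuhom A A') :
    nuhom (semidirect (cohn_action A)) (semidirect (cohn_action A')) :=
  sd_map (matmap_act_left f) (matmap_act_right f).

Local Notation o := (iota [::]).
Local Notation one e := (iota [:: e]).

Lemma shift_origin x : shift_fun x o = None.
Proof. by rewrite shift_fun_iota; case: x. Qed.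

Lemma shift_edge_one f e : shift_fun (CEdge f) (one e) = None.
Proof. by rewrite shift_fun_iota /= andbF. Qed.

Lemma shift_vert_one v e :
  shift_fun (CVert v) (one e) = if src e == v then Some (one e) else None.
Proof. by rewrite shift_fun_iota /=; case: ifP. Qed.

(** Every generator kills the empty path. The index [o] is thus free to carry a second copy of C(E),
    orthogonal to the one embedded by [sd_sec]. *)
Lemma act_left_origin A b s (a : A) :
  act_left (cohn_action A) b (mat_single o s a) = 0.
Proof.
elim/pres_gen_ind: b => [x||k b hb|b c hb hc|b c hb hc].
- by rewrite cohn_act_leftE row_op_single [pinv _ _]shift_origin.
- exact: act_left0.
- by rewrite act_leftZ hb scaler0.
- by rewrite act_leftD hb hc addr0.
- by rewrite act_leftM hc linear0.
Qed.

Lemma act_right_origin A b s (a : A) :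
  act_right (cohn_action A) b (mat_single s o a) = 0.
Proof.
elim/pres_gen_ind: b => [x||k b hb|b c hb hc|b c hb hc].
- by rewrite cohn_act_rightE col_op_single [pfun _ _]shift_origin.
- exact: act_right0.
- by rewrite act_rightZ hb scaler0.
- by rewrite act_rightD hb hc addr0.
- by rewrite act_rightM hb linear0.
Qed.

(** Removing the only edge would leave the empty path, which [starts] rejects: here the truncation
    differs from the full Fock representation. *)
Lemma act_left_ghost_one A f e s (a : A) :
  act_left (cohn_action A) (gen (CGhost f)) (mat_single (one e) s a) = 0.
Proof. by rewrite cohn_act_leftE row_op_single [pinv _ _]shift_edge_one. Qed.

Lemma act_right_edge_one A f e s (a : A) :
  act_right (cohn_action A) (gen (CEdge f)) (mat_single s (one e) a) = 0.
Proof. by rewrite cohn_act_rightE col_op_single [pfun _ _]shift_edge_one. Qed.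

Lemma act_left_src_one A e s (a : A) :
  act_left (cohn_action A) (gen (CVert (src e))) (mat_single (one e) s a) =
  mat_single (one e) s a.
Proof. by rewrite cohn_act_leftE row_op_single [pinv _ _]shift_vert_one eqxx. Qed.

Lemma act_right_src_one A e s (a : A) :
  act_right (cohn_action A) (gen (CVert (src e))) (mat_single s (one e) a) =
  mat_single s (one e) a.
Proof. by rewrite cohn_act_rightE col_op_single [pfun _ _]shift_vert_one eqxx. Qed.

Lemma origin_eq_one e : (o == one e) = false.
Proof. by apply/eqP => /iota_inj. Qed.

Lemma one_eq_origin e : (one e == o) = false.
Proof. by apply/eqP => /iota_inj. Qed.

Lemma one_eq e f : (one e == one f) = (e == f).
Proof. by apply/eqP/eqP => [/iota_inj[]|->]. Qed.

End CohnAction.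

(** * Quasi-homomorphisms out of the Cohn path algebra *)

(* The relations in [A] under which [td_gen] below defines a homomorphism. *)
Record toeplitz_data (l : comPzRingType) (E : digraph) (A : nualg l) := ToeplitzData {
  td_p : vert E -> A;
  td_a : edge E -> A;
  td_b : edge E -> A;
  td_a' : edge E -> A;
  td_b' : edge E -> A;
  td_pp : forall v, td_p v *n td_p v = td_p v;
  td_pw : forall v w, v <> w -> td_p v *n td_p w = 0;
  td_pb : forall e, td_p (src e) *n td_b e = td_b e;
  td_ap : forall e, td_a e *n td_p (rng e) = td_a e;
  td_bp : forall e, td_b e *n td_p (rng e) = td_b e;
  td_pa' : forall e, td_p (rng e) *n td_a' e = td_a' e;
  td_pb' : forall e, td_p (rng e) *n td_b' e = td_b' e;
  td_b'p : forall e, td_b' e *n td_p (src e) = td_b' e;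
  td_isometry : forall e, td_a' e *n td_a e + td_b' e *n td_b e = td_p (rng e);
  td_orthogonal : forall e f, e <> f -> td_b' e *n td_b f = 0 }.

Section ToeplitzHom.
Variables (l : comPzRingType) (E : digraph) (S : choiceType).
Variables (iota : seq (edge E) -> S) (iota_inj : injective iota).
Local Notation C := (cohn l E).
Local Notation gen x := (pres_gen (@cohn_rel l E) x).
Local Notation o := (iota [::]).
Local Notation one e := (iota [:: e]).
Local Notation act A := (cohn_action iota_inj A).

Definition td_gen (A : nualg l) (d : toeplitz_data E A) (x : cohn_gen E) : matalg S A :=
  match x with
  | CVert v => mat_single o o (td_p d v)
  | CEdge e => mat_single (one e) o (td_a d e) + mat_single o o (td_b d e)
  | CGhost e => mat_single o (one e) (td_a' d e) + mat_single o o (td_b' d e)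
  end.

(** For the entries at [one e] the source relations are provided by the action, so the data impose
    them only on [td_b] and [td_b']. Entries at [one e] and [one f] with distinct edges multiply to
    zero, so orthogonality too concerns only [td_b'] and [td_b]. *)
Lemma td_hom_rel (A : nualg l) (d : toeplitz_data E A) t u : @cohn_rel l E t u ->
  aeval (fun x => (gen x, td_gen d x) : semidirect (act A)) t =
  aeval (fun x => (gen x, td_gen d x) : semidirect (act A)) u.
Proof.
have single_mul s u v w (x y : A) := @mat_singleM l S A s u v w x y.
have simp := (origin_eq_one iota_inj, one_eq_origin iota_inj, one_eq iota_inj, eqxx).
have mulE (M N : matalg S A) : matalg_mul M N = M *n N by [].
have actE := (act_left_origin, act_right_origin, act_left_ghost_one,
  act_right_edge_one, act_left_src_one, act_right_src_one).
move=> tu; have r := pres_rel tu.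
case: tu r => [v|v w vw|e|e|e|e|e|e f ef] r; congr pair; try exact: r;
 rewrite [LHS]/= mulE ?act_leftDr ?act_rightDr
   ?nu_mulDl ?nu_mulDr /td_gen !actE ?single_mul ?simp ?addr0 ?add0r.
- by rewrite td_pp.
- by rewrite td_pw // mat_single0.
- by rewrite td_pb.
- by rewrite td_ap td_bp.
- by rewrite td_pa' td_pb'.
- by rewrite td_b'p.
- by rewrite -mat_singleD td_isometry.
- by rewrite td_orthogonal // mat_single0 addr0; case: eqP.
Qed.

Definition td_hom (A : nualg l) (d : toeplitz_data E A) : nuhom C (semidirect (act A)) :=
  pres_map (td_hom_rel d).

Lemma td_hom_gen (A : nualg l) (d : toeplitz_data E A) x :
  td_hom d (gen x) = (gen x, td_gen d x).
Proof. exact: pres_map_gen. Qed.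

Lemma td_hom_proj (A : nualg l) (d : toeplitz_data E A) x :
  sd_proj (act A) (td_hom d x) = x.
Proof.
suff e : nucomp (sd_proj (act A)) (td_hom d) = nuid C by exact: (congr1 (fun f => nuh_fun f x) e).
by apply: pres_hom_ext => y /=; rewrite td_hom_gen.
Qed.

Definition td_map (A A' : nualg l) (u : nuhom A A')
    (d : toeplitz_data E A) (d' : toeplitz_data E A') :=
  [/\ forall v, u (td_p d v) = td_p d' v,
      forall e, u (td_a d e) = td_a d' e, forall e, u (td_b d e) = td_b d' e,
      forall e, u (td_a' d e) = td_a' d' e & forall e, u (td_b' d e) = td_b' d' e].

Lemma td_map_hom (A A' : nualg l) (u : nuhom A A')
    (d : toeplitz_data E A) (d' : toeplitz_data E A') :
  td_map u d d' -> nucomp (cohn_sd_map iota_inj u) (td_hom d) = td_hom d'.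
Proof.
move=> [hp ha hb ha' hb']; apply: pres_hom_ext => x.
rewrite td_hom_gen /= td_hom_gen; congr pair.
have S1 s t y : matmap_fun u (mat_single s t y) = mat_single s t (u y).
  exact: matmap_single.
by case: x => [v|e|e]; rewrite /= ?matmap_funD !S1 ?hp ?ha ?hb ?ha' ?hb'.
Qed.

End ToeplitzHom.

(** * Linear homotopies between families *)

Section ToeplitzHomotopy.
Variables (l : comPzRingType) (E : digraph) (A : nualg l).
Implicit Types d : toeplitz_data E A.
Local Notation cst := (polyalg_const A).
Local Notation seg := (@segment l A).

(** The segments between the two families satisfy the relations: in each product the factor that
    does not move is constant by [segmentxx], and what remains is affine. *)
Lemma td_homotopy d d' : td_p d = td_p d' ->
  (td_a d = td_a d' /\ td_b d = td_b d') \/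
  (td_a' d = td_a' d' /\ td_b' d = td_b' d') ->
  exists h : toeplitz_data E (polyalg A), td_map (ev0 A) h d /\ td_map (ev1 A) h d'.
Proof.
case: d d' => [p a b a' b' pp pw pb ap bp pa' pb' b'p iso orth].
case=> [q c f c' f' qq qw qf cq fq qc' qf' f'q iso' orth'] /= pq h; subst q.
unshelve eexists.
  apply: (@ToeplitzData l E (polyalg A) (fun v => cst (p v))
    (fun e => seg (a e) (c e)) (fun e => seg (b e) (f e))
    (fun e => seg (a' e) (c' e)) (fun e => seg (b' e) (f' e))).
  - by move=> v; rewrite -nuhM pp.
  - by move=> v w vw; rewrite -nuhM pw // linear0.
  - by move=> e; rewrite segmentMl pb qf.
  - by move=> e; rewrite segmentMr ap cq.
  - by move=> e; rewrite segmentMr bp fq.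
  - by move=> e; rewrite segmentMl pa' qc'.
  - by move=> e; rewrite segmentMl pb' qf'.
  - by move=> e; rewrite segmentMr b'p f'q.
  - move=> e; case: h => -[? ?]; subst.
      by rewrite !segmentxx !segmentMr segmentD iso iso' segmentxx.
    by rewrite !segmentxx !segmentMl segmentD iso iso' segmentxx.
  - move=> e f0 ef; case: h => -[? ?]; subst.
      by rewrite !segmentxx !segmentMr orth // orth' // segmentxx linear0.
    by rewrite !segmentxx !segmentMl orth // orth' // segmentxx linear0.
by split; split=> e; rewrite ?ev0_segment ?ev1_segment //= ?ev1_single.
Qed.

End ToeplitzHomotopy.

(** With [k] inverse to [ka], the arrow [k \oc q] is a left inverse of [f] directly, and a right
    inverse after inserting the inverse of [kb] and using the square. *)
Lemma iso_of_factorization (K : category) (a b a' b' : K) (f : mor a b)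
    (ka : mor a a') (kb : mor b b') (m : mor a' b') (q : mor b a') :
  is_iso ka -> is_iso kb -> m \oc ka = kb \oc f -> q \oc f = ka -> m \oc q = kb ->
  is_iso f.
Proof.
move=> [k [kka kak]] [k' [kkb _]] mka qf mq; exists (k \oc q).
split; first by rewrite -mcompA qf.
rewrite -[LHS]mcomp1m -kkb -mcompA [X in _ \oc X]mcompA [X in _ \oc X]mcompA -mka.
by rewrite -(mcompA m) kak mcompm1 mq.
Qed.

(** * The families in C(E) and in the function algebra *)

Section CohnData.
Variables (l : comPzRingType) (E : digraph).
Local Notation C := (cohn l E).
Local Notation V v := (pres_gen (@cohn_rel l E) (CVert v)).
Local Notation D e := (pres_gen (@cohn_rel l E) (CEdge e)).
Local Notation G e := (pres_gen (@cohn_rel l E) (CGhost e)).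

Let gate (b : bool) (x : C) : C := if b then x else 0.

Let gateMl b x y : x *n gate b y = gate b (x *n y).
Proof. by case: b => //; rewrite /gate nu_mul0. Qed.

Let gateMr b x y : gate b x *n y = gate b (x *n y).
Proof. by case: b => //; rewrite /gate nu_0mul. Qed.

(* [i], [j], [i'], [j'] switch the entries a = r(e), b = e, a' = r(e) and
   b' = the ghost of e on or off. *)
Definition cohn_data (i j i' j' : bool) (h : (i && i') != (j && j')) :
  toeplitz_data E C.
Proof.
apply: (@ToeplitzData l E C (fun v => V v)
  (fun e => gate i (V (rng e))) (fun e => gate j (D e))
  (fun e => gate i' (V (rng e))) (fun e => gate j' (G e))).
- by move=> v; exact: (pres_rel (cohn_vv l v)).
- by move=> v w vw; exact: (pres_rel (cohn_vw l vw)).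
- by move=> e; rewrite gateMl [_ *n _](pres_rel (cohn_se l e)).
- by move=> e; rewrite gateMr [_ *n _](pres_rel (cohn_vv l (rng e))).
- by move=> e; rewrite gateMr [_ *n _](pres_rel (cohn_er l e)).
- by move=> e; rewrite gateMl [_ *n _](pres_rel (cohn_vv l (rng e))).
- by move=> e; rewrite gateMl [_ *n _](pres_rel (cohn_rg l e)).
- by move=> e; rewrite gateMr [_ *n _](pres_rel (cohn_gs l e)).
(* Each of a'a and b'b equals r(e) when both of its factors are switched on; by [h] exactly one of
   the two products is on. *)
- move=> e; rewrite !gateMl !gateMr.
  rewrite [_ *n V _](pres_rel (cohn_vv l (rng e))) [_ *n D _](pres_rel (cohn_gee l e)).
  by move: h; case: i; case: i'; case: j; case: j' => //= _; rewrite ?addr0 ?add0r.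
- move=> e f ef; rewrite gateMl gateMr [_ *n _](pres_rel (cohn_gef l ef)) /=.
  by case: (j); case: (j').
Defined.

Lemma chiM (v w : vert E) : chi l v *n chi l w = if v == w then chi l v else 0.
Proof.
apply: fsP => u; rewrite [LHS]/=.
case: (v =P w) => [<-|vw].
  by rewrite fs_singleE; case: eqP => _; rewrite ?mulr1 ?mulr0.
by case: (u =P v) => [->|_]; rewrite ?mul0r //; case: eqP; rewrite ?mulr0.
Qed.

(** Several edges may share a range, so the range projections could not serve as b and b'; as a and
    a' they are subject to no orthogonality. *)
Definition funalg_data : toeplitz_data E (funalg l (vert E)).
Proof.
refine (@ToeplitzData l E (funalg l (vert E)) (fun v => chi l v)
  (fun e => chi l (rng e)) (fun=> 0) (fun e => chi l (rng e)) (fun=> 0)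
  _ _ _ _ _ _ _ _ _ _) => *; rewrite ?nu_mul0 ?nu_0mul ?addr0 ?chiM ?eqxx //.
by case: eqP.
Defined.

Lemma cohn_phi_data (h : (true && true) != (false && false)) :
  td_map (cohn_phi l E) funalg_data (cohn_data h).
Proof. by split=> v //; rewrite ?linear0 //; exact: cohn_phiE. Qed.

End CohnData.

(** * Classes of the quasi-homomorphisms and their homotopy invariance *)

Section QuasiHom.
Variables (l : comPzRingType) (E : digraph) (S : choiceType).
Variables (iota : seq (edge E) -> S) (iota_inj : injective iota).
Variables (T : triCat) (X : boundary_theory l T).
Hypotheses (X_excisive : excisive X) (X_homotopy : homotopy_invariant X).
Hypothesis X_stable : matrix_stable X S.
Local Notation "g \oc f" :=
  (@mcomp (category_of_additive (tri_add T)) _ _ _ g f) : category_scope.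
Local Notation hom x y := (@ahom (tri_add T) x y) (only parsing).
Local Notation C := (cohn l E).
Local Notation o := (iota [::]).
Local Notation act A := (cohn_action iota_inj A).
Local Notation map f := (hmap X f).
Implicit Types A : nualg l.

(* [q] is the class of the quasi-homomorphism (td_hom d, sd_sec) from [C] to
   the ideal [matalg S A]. *)
Definition quasi_class A (d : toeplitz_data E A) (q : hom (X C) (X (matalg S A))) :=
  map (sd_inj (act A)) \oc q = map (td_hom iota_inj d) - map (sd_sec (act A)).

Lemma quasi_class_exists A (d : toeplitz_data E A) : exists q, quasi_class d q.
Proof.
have [q qE] := hmap_sd_lift X_excisive (td_hom_proj iota_inj d : forall x, _ = nuid C x).
by exists q; rewrite /quasi_class qE nucompm1.
Qed.

Lemma quasi_class_uniq A (d : toeplitz_data E A) q q' :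
  quasi_class d q -> quasi_class d q' -> q = q'.
Proof. by rewrite /quasi_class => <- /(hmap_sd_inj_mono X_excisive) ->. Qed.

Lemma quasi_class_map A A' (u : nuhom A A') (d : toeplitz_data E A)
    (d' : toeplitz_data E A') q :
  td_map u d d' -> quasi_class d q -> quasi_class d' (map (matmap S u) \oc q).
Proof.
move=> ud dq; rewrite /quasi_class mcompA -hmap_comp.
rewrite (_ : nucomp _ _ = nucomp (cohn_sd_map iota_inj u) (sd_inj (act A))); last first.
  exact: nuhom_ext.
rewrite hmap_comp -mcompA dq mcompDr mcompNr -!hmap_comp (td_map_hom iota_inj ud).
congr (_ - map _); apply: nuhom_ext => x /=; congr pair; exact: linear0.
Qed.

(** Both evaluations are left inverse to the inclusion of constants, which [X] makes invertible. *)
Lemma hmap_ev A : map (ev0 A) = map (ev1 A).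
Proof.
have [g [_ cg]] := X_homotopy A.
have e0 : nucomp (ev0 A) (polyalg_const A) = nuid A by apply: nuhom_ext.
have e1 : nucomp (ev1 A) (polyalg_const A) = nuid A.
  by apply: nuhom_ext => x; exact: ev1_single.
rewrite -[LHS](@mcompm1 T) -[RHS](@mcompm1 T) -cg !mcompA.
by rewrite -[fmap X _]/(map (polyalg_const A)) -!hmap_comp e0 e1.
Qed.

(** Naturality of the corner, invertible under [X], reduces this to [hmap_ev] without comparing
    matrices over polynomials with polynomials over matrices. *)
Lemma hmap_matmap_ev A : map (matmap S (ev0 A)) = map (matmap S (ev1 A)).
Proof.
have [g [_ cg]] := X_stable (polyalg A) o.
rewrite -[LHS](@mcompm1 T) -[RHS](@mcompm1 T) -cg !mcompA.
rewrite -[fmap X _]/(map (mat_corner (polyalg A) o)) -!hmap_comp !matmap_corner.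
by rewrite !hmap_comp hmap_ev.
Qed.

(** The homotopy has a class over A[t]; its images under the two evaluations are the classes of [d]
    and [d']. *)
Lemma quasi_class_homotopy A (d d' : toeplitz_data E A) q :
  td_p d = td_p d' ->
  (td_a d = td_a d' /\ td_b d = td_b d') \/
  (td_a' d = td_a' d' /\ td_b' d = td_b' d') ->
  quasi_class d q -> quasi_class d' q.
Proof.
move=> dp h dq; have [t [t0 t1]] := td_homotopy dp h.
have [r tr] := quasi_class_exists t.
rewrite (quasi_class_uniq dq (quasi_class_map t0 tr)) hmap_matmap_ev.
exact: quasi_class_map tr.
Qed.

Lemma sd_mul_sec_corner A b x :
  sd_sec (act A) b *n sd_inj (act A) (mat_corner A o x) = 0.
Proof.
by rewrite sd_mulE nu_mul0 nu_0mul [act_left _ _ _]act_left_origin linear0 !addr0.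
Qed.

Lemma sd_mul_corner_sec A b x :
  sd_inj (act A) (mat_corner A o x) *n sd_sec (act A) b = 0.
Proof.
by rewrite sd_mulE nu_0mul nu_mul0 [act_right _ _ _]act_right_origin linear0 !addr0.
Qed.

(** Along [u], the homomorphism [td_hom iota_inj d] is the orthogonal sum of [sd_sec] after [u] and
    of the corner after [v]; subtracting the former leaves the corner. *)
Lemma quasi_class_orthogonal A A' (d : toeplitz_data E A) q
    (u : nuhom A' C) (v : nuhom A' A) : quasi_class d q ->
  (forall x, td_hom iota_inj d (u x) = (u x, mat_single o o (v x))) ->
  q \oc map u = map (nucomp (mat_corner A o) v).
Proof.
move=> dq duv; apply: (hmap_sd_inj_mono X_excisive (r := act A)).
rewrite mcompA dq mcompDl mcompNl -!hmap_comp.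
rewrite (@hmap_orthogonal_sum _ _ _ X_excisive _ _ (nucomp (sd_sec (act A)) u)
  (nucomp (sd_inj (act A)) (nucomp (mat_corner A o) v))).
- by rewrite addrAC subrr add0r.
- by move=> x; rewrite /= duv; congr pair; rewrite /= ?addr0 ?add0r.
- by move=> x y; exact: sd_mul_sec_corner.
- by move=> x y; exact: sd_mul_corner_sec.
Qed.

Lemma td_hom_phi (f : funalg l (vert E)) :
  td_hom iota_inj (funalg_data l E) (cohn_phi l E f) = (cohn_phi l E f, mat_single o o f).
Proof.
elim/fs_ind: f => [|v a|f g hf hg].
- by rewrite !linear0.
- have -> : fs_single v a = (a : l) *: chi l v :> funalg l (vert E).
    apply: fsP => w; rewrite fs_scale !fs_singleE.
    by case: ifP => _; rewrite /GRing.scale /= ?mulr1 ?mulr0.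
  rewrite !linearZ cohn_phiE /= [td_hom _ _ _]td_hom_gen /=.
  by congr pair; rewrite [RHS]linearZ.
- by rewrite !linearD /= hf hg.
Qed.

(** With only b and b' switched on, [td_gen] places each generator itself at [(o, o)], and there the
    second component is multiplicative because the action vanishes. *)
Lemma td_hom_corner (h : (false && false) != (true && true)) (b : C) :
  td_hom iota_inj (cohn_data l E h) b = (b, mat_single o o b).
Proof.
elim/pres_gen_ind: b => [x||a b hb|b c hb hc|b c hb hc].
- by rewrite td_hom_gen; congr pair; case: x => [v|e|e] //=; rewrite mat_single0 add0r.
- by rewrite linear0 mat_single0.
- by rewrite linearZ /= hb; congr pair; rewrite [RHS]linearZ.
- by rewrite linearD /= hb hc; congr pair; rewrite [RHS]linearD.
- rewrite nuhM hb hc sd_mulE act_left_origin act_right_origin mat_singleM eqxx.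
  by rewrite !add0r.
Qed.

Lemma hmap_cohn_phi_iso : is_iso (fmap X (cohn_phi l E : @mor (Alg l) _ _)).
Proof.
have [q1 q1P] := quasi_class_exists (funalg_data l E).
have h1 : (true && true) != (false && false) by [].
have h2 : (true && true) != (true && false) by [].
have h3 : (true && false) != (true && true) by [].
have h4 : (false && false) != (true && true) by [].
have q2P := quasi_class_map (cohn_phi_data l E h1) q1P.
(* The three homotopies fix in turn (a', b'), (a, b) and again (a', b'). *)
have q3P := quasi_class_homotopy (d := cohn_data l E h1) (d' := cohn_data l E h2) erefl
  (or_intror (conj erefl erefl)) q2P.
have q4P := quasi_class_homotopy (d := cohn_data l E h2) (d' := cohn_data l E h3) erefl
  (or_introl (conj erefl erefl)) q3P.
have q5P := quasi_class_homotopy (d := cohn_data l E h3) (d' := cohn_data l E h4) erefl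
  (or_intror (conj erefl erefl)) q4P.
(* [e1] will give the left inverse of the class of [cohn_phi], and [e2] the right inverse. *)
have e1 := quasi_class_orthogonal (v := nuid _) q1P td_hom_phi.
have e2 := quasi_class_orthogonal (u := nuid C) (v := nuid C) q5P (td_hom_corner h4).
move: e1 e2; rewrite !nucompm1 hmap_id (mcompm1 (_ : @mor T _ _)) => e1 e2.
apply: (iso_of_factorization (X_stable _ o) (X_stable _ o) _ e1 e2).
by rewrite -[LHS]hmap_comp -[RHS]hmap_comp matmap_corner.
Qed.

End QuasiHom.

Theorem theorem4p2 (l : comPzRingType) (E : digraph) (kk : triCat)
    (j : boundary_theory l kk) (hj : universal_theory E j) :
  is_iso (fmap j (cohn_phi l E : @mor (Alg l) (funalg l (vert E)) (cohn l E))).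
Proof.
have [j_exc j_htpy j_stable _] := hj.
(* The summand [nat] makes the index set infinite, and lists of edges are lists over it. *)
have [m n []//|f f_inj] := @seq_embedding (vert E + edge E + nat)%type inr.
have g_inj : injective (fun e : edge E => inl (inr e) : (vert E + edge E + nat)%type).
  by move=> x y [].
exact: (hmap_cohn_phi_iso (inj_comp f_inj (inj_map g_inj)) j_exc j_htpy j_stable).
Qed.
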